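(* For a finite free BKF-module $M$ of rank $r\in\mathbb{N}$, \[ t_{H}(M\otimes\mathcal{O}_{L}) \leq t_{H}(M\otimes E)\quad\text{in}\quad\mathbb{Z}_{\geq}^{r}, \qquad t_{H}(M\otimes\mathcal{O}_{K}^{\flat}) \leq t_{H}(M\otimes E)\quad \text{in}\quad\mathbb{R}_{\geq}^{r}. \]
   Context: $E$ is a finite extension of $\mathbb{Q}_p$ with uniformizer $\pi$ and residue field $\mathbb{F}_q$, $K$ a perfectoid field extension of $E$, $K^\flat$ its tilt with valuation ring $\mathcal{O}_K^\flat$ and residue field $\mathbb{F}$. $A=W_{\mathcal{O}_E}(\mathcal{O}_K^\flat)$, $\mathcal{O}_L=W_{\mathcal{O}_E}(\mathbb{F})$, $L=\mathrm{Frac}(\mathcal{O}_L)$, $\varphi$ the Frobenius lifting $x\mapsto x^q$; $A\to A/\pi=\mathcal{O}_K^\flat$ and $A\to\mathcal{O}_L$ are the natural maps. $\xi$ is a generator of the kernel of the usual surjection $\theta:A\twoheadrightarrow\mathcal{O}_K$, $\xi'=\varphi(\xi)$, $\varpi=\xi\bmod\pi$. The absolute value on $K^\flat$ is normalized by $q|\varpi^q|=1$. $B_{dR}'^+$ is the completion of the local ring of $A[\frac1\pi]$ at the maximal ideal generated by $\xi'$, a discrete valuation ring with uniformizer $\xi'$ and fraction field $B'_{dR}$; on $B'_{dR}$ normalize $|\xi'|=q^{-1}$, and on $L$ normalize $|\pi|=q^{-1}$ (the image of $\xi'$ in $\mathcal{O}_L$ is a uniformizer). A finite free BKF-module is a finite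 free $A$-module $M$ with an isomorphism $\varphi_M:(\varphi^*M)[\xi'^{-1}]\to M[\xi'^{-1}]$. The element $\xi'$ becomes invertible in $K^\flat$, $L$ and $B_{dR}'$. For $S\in\{B_{dR}'^+,\mathcal{O}_L,\mathcal{O}_K^\flat\}$ with fraction field $F$, both $M\otimes_AS$ and $\varphi_M(\varphi^*M\otimes_AS)$ are $S$-lattices in $M\otimes_AF$. For two $S$-lattices $L_1,L_2$ in an $r$-dimensional $F$-vector space there are a basis $(e_i)$ of $L_1$ and $x_i\in F^\times$ with $|x_1|\ge\dots\ge|x_r|$ such that $(x_ie_i)$ is a basis of $L_2$; set $\mathbf{d}(L_1,L_2)=(\log_q|x_1|,\dots,\log_q|x_r|)$. The Hodge types $t_H(M\otimes E)$, $t_H(M\otimes\mathcal{O}_L)$ and $t_H(M\otimes\mathcal{O}_K^\flat)$ are $\mathbf{d}\big(M\otimes S,\varphi_M(\varphi^*M\otimes S)\big)$ for $S=B_{dR}'^+,\ \mathcal{O}_L,\ \mathcal{O}_K^\flat$ respectively (elements of $\mathbb{Z}^r_\ge$, $\mathbb{Z}^r_\ge$, $\mathbb{R}^r_\ge$). On $\mathbb{R}^r_\ge=\{(\gamma_1\ge\dots\ge\gamma_r)\}$ and $\mathbb{Z}^r_\ge\subset\mathbb{R}^r_\ge$: $(\gamma_i)\le(\gamma_i')$ iff $\gamma_1+\dots+\gamma_s\le\gamma'_1+\dots+\gamma'_s$ for all $s\le r$ with equality for $s=r$. *)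

(* Defs.v *)
From HB Require Import structures.
From mathcomp Require Import all_boot all_order all_algebra all_field.
From mathcomp Require Import fraction generic_quotient.
From mathcomp Require Import boolp classical_sets reals exp.
Set Implicit Arguments.
Unset Strict Implicit.
Unset Printing Implicit Defensive.
Import Order.TTheory GRing.Theory Num.Theory.
Local Open Scope ring_scope.
Local Open Scope classical_set_scope.
Local Open Scope quotient_scope.

Record absval (R : realType) (F : fieldType) := AbsVal {
  absval_fun :> F -> R;
  absval_ge0 : forall x, 0 <= absval_fun x;
  absval_eq0 : forall x, absval_fun x = 0 -> x = 0;
  absval1 : absval_fun 1 = 1;
  absvalM : forall x y, absval_fun (x * y) = absval_fun x * absval_fun y;
  absvalD : forall x y,
    absval_fun (x + y) <= Num.max (absval_fun x) (absval_fun y)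
}.

Section AbsVal.
Variables (R : realType) (F : fieldType) (v : absval R F).

Definition absval_cvg (u : nat -> F) (l : F) : Prop :=
  forall e : R, 0 < e ->
  exists N : nat, forall n, (N <= n)%N -> v (u n - l) < e.

Definition absval_cauchy (u : nat -> F) : Prop :=
  forall e : R, 0 < e ->
  exists N : nat, forall m n, (N <= m)%N -> (N <= n)%N -> v (u m - u n) < e.

Definition absval_complete : Prop :=
  forall u, absval_cauchy u -> exists l, absval_cvg u l.

Definition integral_elt : pred F := [pred x | v x <= 1].

Lemma absvalN1 : v (-1) = 1.
Proof.
have /eqP : v (-1) ^+ 2 = 1 by rewrite expr2 -absvalM mulrNN mulr1 absval1.
by rewrite sqrp_eq1 ?absval_ge0// => /eqP.
Qed.

Lemma absvalN x : v (- x) = v x.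
Proof. by rewrite -mulN1r absvalM absvalN1 mul1r. Qed.

Lemma integral_subring_closed : subring_closed integral_elt.
Proof.
split=> [|x y|x y]; rewrite /integral_elt !inE ?absval1//.
- move=> hx hy; apply: le_trans (absvalD _ _ _) _.
  by rewrite ge_max absvalN hx hy.
- by move=> hx hy; rewrite absvalM mulr_ile1 ?absval_ge0.
Qed.

HB.instance Definition _ :=
  GRing.isSubringClosed.Build F integral_elt integral_subring_closed.

Record valring := ValRing { valring_val : F; _ : valring_val \in integral_elt }.

HB.instance Definition _ := [isSub for valring_val].
HB.instance Definition _ := [Choice of valring by <:].
HB.instance Definition _ := [SubChoice_isSubComNzRing of valring by <:].

Definition is_residue_map (k : fieldType) (rho : {rmorphism valring -> k}) :
  Prop :=
  (forall y, exists x, rho x = y) /\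
  (forall x, rho x = 0 <-> v (\val x) < 1).

Definition is_uniformizer (x : valring) : Prop :=
  \val x != 0 /\ v (\val x) < 1 /\
  forall y : valring, v (\val y) < 1 -> exists z, y = z * x.

End AbsVal.

(* Q_p is the completion of Q for the p-adic absolute value; a nonarchimedean
   absolute value with |p| = 1/p restricts to the p-adic one on Q. *)
Definition is_padic_field (R : realType) (F : fieldType) (v : absval R F)
    (p : nat) : Prop :=
  [/\ v p%:R = p%:R^-1, absval_complete v &
      forall (x : F) (e : R), 0 < e -> exists r : rat, v (x - ratr r) < e].

Record local_field (R : realType) := LocalField {
  lf_p : nat;
  lf_p_prime : prime lf_p;
  lf_Qp : fieldType;
  lf_vp : absval R lf_Qp;
  lf_padic : is_padic_field lf_vp lf_p;
  lf_E :> fieldExtType lf_Qp;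
  lf_v : absval R lf_E;
  lf_v_ext : forall x : lf_Qp, lf_v x%:A = lf_vp x;
  lf_pi : valring lf_v;
  lf_pi_unif : is_uniformizer lf_pi;
  lf_k : finFieldType;
  lf_res : {rmorphism valring lf_v -> lf_k};
  lf_resP : is_residue_map lf_res
}.

Definition lf_q (R : realType) (E : local_field R) : nat := #|lf_k E|.

Definition is_perfectoid (R : realType) (K : fieldType) (v : absval R K)
    (p : nat) : Prop :=
  [/\ v p%:R < 1,
      absval_complete v,
      forall e : R, 0 < e -> exists x, 1 - e < v x < 1 &
      forall x, v x <= 1 ->
        exists y z, [/\ v y <= 1, v z <= 1 & x = y ^+ p + p%:R * z]].

Record perfectoid_ext (R : realType) (E : local_field R) := PerfectoidExt {
  pf_K :> fieldType;
  pf_v : absval R pf_K;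
  pf_in : {rmorphism E -> pf_K};
  pf_v_ext : forall x : E, pf_v (pf_in x) = lf_v E x;
  pf_perfectoid : is_perfectoid pf_v (lf_p E)
}.

(* K^flat is the set of sequences (s_n) in K with s_(n+1)^p = s_n, multiplied
   termwise and added by (s + t)_n = lim_m (s_(n+m) + t_(n+m))^(p^m);
   [tilt_coord n] is the n-th term, so [tilt_coord 0] is x |-> x^sharp.
   The absolute value is |x^sharp| up to the choice of the exponent. *)
Record tilt (R : realType) (K : fieldType) (v : absval R K) (p : nat) := Tilt {
  tilt_K :> fieldType;
  tilt_coord : nat -> tilt_K -> K;
  tilt_coordX : forall n x, tilt_coord n.+1 x ^+ p = tilt_coord n x;
  tilt_coord_bij : forall s : nat -> K, (forall n, s n.+1 ^+ p = s n) ->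
    exists! x, forall n, tilt_coord n x = s n;
  tilt_coordM : forall n x y,
    tilt_coord n (x * y) = tilt_coord n x * tilt_coord n y;
  tilt_coordD : forall n x y,
    absval_cvg v
      (fun m => (tilt_coord (n + m)%N x + tilt_coord (n + m)%N y) ^+ (p ^ m)%N)
      (tilt_coord n (x + y));
  tilt_v : absval R tilt_K;
  tilt_vE : exists2 c : R, 0 < c &
    forall x, tilt_v x = v (tilt_coord 0%N x) `^ c
}.

Definition sharp (R : realType) (K : fieldType) (v : absval R K) (p : nat)
  (Kb : tilt v p) : Kb -> K := tilt_coord 0%N.

(* W_O(B), for O with uniformizer pi and B a perfect O/pi-algebra (with
   structure map [str : O -> O/pi -> B]): the pi-torsion-free, pi-adically
   separated and complete O-algebra W with W/pi = B, unique up to unique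
   isomorphism. B is always a domain below, hence so is W. *)
Record witt_vectors (O : comNzRingType) (pi : O) (B : comNzRingType)
    (str : {rmorphism O -> B}) := WittVectors {
  witt :> idomainType;
  witt_str : {rmorphism O -> witt};
  witt_red : {rmorphism witt -> B};
  witt_red_str : forall c, witt_red (witt_str c) = str c;
  witt_red_surj : forall b, exists a, witt_red a = b;
  witt_red_ker : forall a, witt_red a = 0 <-> exists b, a = witt_str pi * b;
  witt_torsionfree : forall a, witt_str pi * a = 0 -> a = 0;
  witt_separated : forall a,
    (forall n, exists b, a = witt_str pi ^+ n * b) -> a = 0;
  witt_complete : forall u : nat -> witt,
    (forall n, exists b, u n.+1 - u n = witt_str pi ^+ n * b) ->
    exists l, forall n, exists b, u n - l = witt_str pi ^+ n * b
}.

(* Localization of a domain at the multiplicative set generated by [T], as a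
   subring of the fraction field. *)
Section Localization.
Variables (A : idomainType) (T : set A).

Definition mulgen (s : A) : Prop :=
  exists2 l : seq A, (forall x, x \in l -> T x) & s = \prod_(x <- l) x.

Definition is_loc (x : {fraction A}) (a s : A) : Prop :=
  mulgen s /\ x = tofrac a / tofrac s.

Definition loc_elt : pred {fraction A} :=
  fun x => `[< exists a s, is_loc x a s >].

Lemma mulgen1 : mulgen 1.
Proof. by exists [::] => //; rewrite big_nil. Qed.

Lemma mulgenM s t : mulgen s -> mulgen t -> mulgen (s * t).
Proof.
move=> [l hl ->] [l' hl' ->]; exists (l ++ l'); last by rewrite big_cat.
by move=> x; rewrite mem_cat => /orP[/hl|/hl'].
Qed.

Lemma loc_subring_closed : subring_closed loc_elt.
Proof.
split.
- apply/asboolP; exists 1, 1; split; first exact: mulgen1.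
  by rewrite rmorph1 divr1.
- move=> x y /asboolP[a [s [hs ->]]] /asboolP[b [t [ht ->]]]; apply/asboolP.
  have [s0|s0] := eqVneq s 0.
    exists (- b), t; split=> //.
    by rewrite s0 rmorph0 invr0 mulr0 sub0r rmorphN mulNr.
  have [t0|t0] := eqVneq t 0.
    by exists a, s; split=> //; rewrite t0 rmorph0 invr0 mulr0 subr0.
  exists (a * t - b * s), (s * t); split; first exact: mulgenM.
  rewrite rmorphB !rmorphM mulrBl.
  have fs : tofrac s != 0 by rewrite tofrac_eq0.
  have ft : tofrac t != 0 by rewrite tofrac_eq0.
  congr (_ - _); first by rewrite -mulf_div divff// mulr1.
  by rewrite [tofrac s * tofrac t]mulrC -mulf_div divff// mulr1.
- move=> x y /asboolP[a [s [hs ->]]] /asboolP[b [t [ht ->]]]; apply/asboolP.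
  exists (a * b), (s * t); split; first exact: mulgenM.
  by rewrite !rmorphM mulf_div.
Qed.

HB.instance Definition _ :=
  GRing.isSubringClosed.Build {fraction A} loc_elt loc_subring_closed.

Record loc := Loc { loc_val : {fraction A}; _ : loc_val \in loc_elt }.

HB.instance Definition _ := [isSub for loc_val].
HB.instance Definition _ := [Choice of loc by <:].
HB.instance Definition _ := [SubChoice_isSubComNzRing of loc by <:].

Definition loc_unit : pred loc := fun x => `[< exists y, y * x = 1 >].
Definition loc_inv (x : loc) : loc :=
  if pselect (exists y, y * x = 1) is left h then projT1 (cid h) else x.

Lemma loc_mulVx : {in loc_unit, left_inverse 1 loc_inv *%R}.
Proof.
move=> x /asboolP hx; rewrite /loc_inv; case: pselect => // h.
exact: projT2 (cid h).
Qed.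

Lemma loc_unitPl (x y : loc) : y * x = 1 -> loc_unit x.
Proof. by move=> h; apply/asboolP; exists y. Qed.

Lemma loc_inv_out : {in [predC loc_unit], loc_inv =1 id}.
Proof.
move=> x /negP hx; rewrite /loc_inv; case: pselect => // h.
by case: hx; apply/asboolP.
Qed.

HB.instance Definition _ :=
  GRing.ComNzRing_hasMulInverse.Build loc loc_mulVx loc_unitPl loc_inv_out.

Lemma loc_domain : GRing.integral_domain_axiom loc.
Proof.
move=> x y h; have : \val x * \val y == 0 by rewrite -rmorphM h rmorph0.
by rewrite mulf_eq0 -!(rmorph0 (\val : loc -> {fraction A})) !(inj_eq val_inj).
Qed.

HB.instance Definition _ :=
  GRing.ComUnitRing_isIntegral.Build loc loc_domain.

Lemma loc_in_subproof (a : A) : tofrac a \in loc_elt.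
Proof.
apply/asboolP; exists a, 1; split; first exact: mulgen1.
by rewrite rmorph1 divr1.
Qed.

Definition loc_in (a : A) : loc := Loc (loc_in_subproof a).

Lemma loc_in_zmod : zmod_morphism loc_in.
Proof. by move=> a b; apply: val_inj; rewrite /= rmorphB. Qed.
Lemma loc_in_monoid : monoid_morphism loc_in.
Proof. by split=> [|a b]; apply: val_inj; rewrite /= ?rmorph1 ?rmorphM. Qed.

HB.instance Definition _ := GRing.isZmodMorphism.Build A loc loc_in loc_in_zmod.
HB.instance Definition _ :=
  GRing.isMonoidMorphism.Build A loc loc_in loc_in_monoid.

Lemma loc_elt_frac (x : loc) :
  exists a_s : A * A, is_loc (\val x) a_s.1 a_s.2.
Proof.
have /asboolP[a [s h]] : loc_elt (\val x) := valP x.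
by exists (a, s).
Qed.

Definition loc_frac (x : loc) : A * A := projT1 (cid (loc_elt_frac x)).

(* a / s |-> g a / g s : the extension of g to the localization, when g maps
   [T] to nonzero elements *)
Definition loc_lift (F : fieldType) (g : A -> F) (x : loc) : F :=
  g (loc_frac x).1 / g (loc_frac x).2.

End Localization.

(* Tensor product S (x)_A M along f : A -> S: formal sums of pairs (s, m),
   modulo the congruence generated by the tensor relations. *)
Section BaseChange.
Variables (A S : comNzRingType) (f : {rmorphism A -> S}) (M : lmodType A).

Inductive tens_eq : seq (S * M) -> seq (S * M) -> Prop :=
| TensRefl u : tens_eq u u
| TensSym u v : tens_eq u v -> tens_eq v u
| TensTrans u v w : tens_eq u v -> tens_eq v w -> tens_eq u w
| TensCat u u' v v' :
    tens_eq u u' -> tens_eq v v' -> tens_eq (u ++ v) (u' ++ v')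
| TensCatC u v : tens_eq (u ++ v) (v ++ u)
| Tens0 m : tens_eq [:: (0, m)] [::]
| TensDl s t m : tens_eq [:: (s + t, m)] [:: (s, m); (t, m)]
| TensDr s m n : tens_eq [:: (s, m + n)] [:: (s, m); (s, n)]
| TensBal s a m : tens_eq [:: (s * f a, m)] [:: (s, a *: m)].

Definition tens_eqb : rel (seq (S * M)) := fun u v => `[< tens_eq u v >].

Lemma tens_eqb_equiv : equiv_class_of tens_eqb.
Proof.
split=> [u|u v|v u w].
- exact/asboolP/TensRefl.
- by apply/asboolP/asboolP; apply: TensSym.
- by move=> /asboolP uv /asboolP vw; apply/asboolP/(TensTrans uv).
Qed.

Canonical tens_equiv := EquivRelPack tens_eqb_equiv.

Definition base_change := {eq_quot tens_eqb}.
HB.instance Definition _ := Choice.on base_change.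
HB.instance Definition _ := EqQuotient.on base_change.

Lemma tensP u v : tens_eq u v <-> \pi_base_change u = \pi_base_change v.
Proof.
split=> [h|/eqmodP/asboolP//].
by apply/eqmodP/asboolP.
Qed.

Lemma tens_repr u : tens_eq (repr (\pi_base_change u)) u.
Proof. by apply/tensP; rewrite reprK. Qed.

Definition tens (s : S) (m : M) : base_change := \pi_base_change [:: (s, m)].

Definition tens_add (x y : base_change) : base_change :=
  \pi_base_change (repr x ++ repr y).

Definition tens_mul (c : S) (u : seq (S * M)) : seq (S * M) :=
  [seq (c * x.1, x.2) | x <- u].

Definition tens_scale (c : S) (x : base_change) : base_change :=
  \pi_base_change (tens_mul c (repr x)).

Definition tens_zero : base_change := \pi_base_change [::].
Definition tens_opp : base_change -> base_change := tens_scale (-1).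

Lemma tens_mul_eq c u v : tens_eq u v -> tens_eq (tens_mul c u) (tens_mul c v).
Proof.
elim=> {u v} [u|u v _ h|u v w _ h _ h'|u u' v v' _ h _ h'|u v|m|s t m|s m n|s a m].
- exact: TensRefl.
- exact: TensSym.
- exact: TensTrans h h'.
- by rewrite /tens_mul !map_cat; apply: TensCat.
- by rewrite /tens_mul !map_cat; apply: TensCatC.
- by rewrite /= mulr0; apply: Tens0.
- by rewrite /= mulrDr; apply: TensDl.
- by rewrite /=; apply: TensDr.
- by rewrite /= mulrA; apply: TensBal.
Qed.

Lemma tens_addE u v :
  tens_add (\pi_base_change u) (\pi_base_change v) =
    \pi_base_change (u ++ v).
Proof. by apply/tensP; apply: TensCat; apply: tens_repr. Qed.

Lemma tens_scaleE c u :
  tens_scale c (\pi_base_change u) = \pi_base_change (tens_mul c u).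
Proof. by apply/tensP; apply: tens_mul_eq; apply: tens_repr. Qed.

Lemma tens_addA : associative tens_add.
Proof.
elim/quotW=> x; elim/quotW=> y; elim/quotW=> z.
by rewrite (tens_addE y z) (tens_addE x y) !tens_addE catA.
Qed.

Lemma tens_addC : commutative tens_add.
Proof.
elim/quotW=> x; elim/quotW=> y; rewrite (tens_addE x y) (tens_addE y x).
by apply/tensP; apply: TensCatC.
Qed.

Lemma tens_add0 : left_id tens_zero tens_add.
Proof. by elim/quotW=> x; rewrite tens_addE. Qed.

Lemma tens_mul0 u : tens_eq (tens_mul 0 u) [::].
Proof.
elim: u => [|[s m] u ih]; first exact: TensRefl.
rewrite /= mul0r -[(0, m) :: _]/([:: (0, m)] ++ _) -[[::]]/([::] ++ [::]).
exact: TensCat (Tens0 m) ih.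
Qed.

Lemma tens_mulD c d u :
  tens_eq (tens_mul (c + d) u) (tens_mul c u ++ tens_mul d u).
Proof.
elim: u => [|[s m] u ih]; first exact: TensRefl.
rewrite /= mulrDl.
apply: (@TensTrans _ ([:: (c * s, m); (d * s, m)] ++
                      (tens_mul c u ++ tens_mul d u))).
  by rewrite -cat1s; apply: TensCat (TensDl _ _ _) ih.
rewrite -[X in tens_eq _ X]cat1s -[X in tens_eq X _]/([:: _] ++ ([:: _] ++ _)).
apply: TensCat; first exact: TensRefl.
rewrite -[X in tens_eq _ (_ ++ X)]cat1s !catA.
by apply: TensCat (TensRefl _); apply: TensCatC.
Qed.

Lemma tens_scaleDl x :
  {morph tens_scale^~ x : c d / c + d >-> tens_add c d}.
Proof.
move=> c d; elim/quotW: x => x.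
rewrite (tens_scaleE c) (tens_scaleE d) (tens_scaleE (c + d)) tens_addE.
by apply/tensP; apply: tens_mulD.
Qed.

Lemma tens_scale1 : left_id 1 tens_scale.
Proof.
elim/quotW=> x; rewrite tens_scaleE; congr \pi_base_change.
by rewrite -[RHS]map_id; apply: eq_map => -[s m] /=; rewrite mul1r.
Qed.

Lemma tens_addN : left_inverse tens_zero tens_opp tens_add.
Proof.
move=> x; rewrite -[x in X in tens_add _ X]tens_scale1 -tens_scaleDl addNr.
by elim/quotW: x => x; rewrite tens_scaleE; apply/tensP; apply: tens_mul0.
Qed.

HB.instance Definition _ :=
  GRing.isZmodule.Build base_change tens_addA tens_addC tens_add0 tens_addN.

Lemma tens_scaleA c d x :
  tens_scale c (tens_scale d x) = tens_scale (c * d) x.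
Proof.
elim/quotW: x => x.
rewrite (tens_scaleE d) (tens_scaleE (c * d)) tens_scaleE.
congr \pi_base_change.
by rewrite /tens_mul -map_comp; apply: eq_map => -[s m] /=; rewrite mulrA.
Qed.

Lemma tens_scaleDr : right_distributive tens_scale +%R.
Proof.
move=> c; elim/quotW=> x; elim/quotW=> y.
rewrite -![_ + _]/(tens_add _ _) (tens_addE x y).
rewrite (tens_scaleE c x) (tens_scaleE c y) (tens_scaleE c (x ++ y)).
by rewrite tens_addE; congr \pi_base_change; rewrite /tens_mul map_cat.
Qed.

HB.instance Definition _ :=
  GRing.Zmodule_isLmodule.Build S base_change
    tens_scaleA tens_scale1 tens_scaleDr tens_scaleDl.

(* s (x) m |-> b s m, for b biadditive and A-balanced *)
Definition tens_lift (N : zmodType) (b : S -> M -> N) (x : base_change) : N :=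
  \sum_(y <- repr x) b y.1 y.2.

End BaseChange.

Definition is_basis (A : comNzRingType) (M : lmodType A) (r : nat)
    (e : 'I_r -> M) : Prop :=
  forall m, exists! c : 'rV[A]_r, m = \sum_(i < r) c 0 i *: e i.

Definition lattice_basis (S : comNzRingType) (F : fieldType)
    (j : {rmorphism S -> F}) (V : lmodType F) (L : set V) (r : nat)
    (e : 'I_r -> V) : Prop :=
  (forall c : 'rV[S]_r, L (\sum_(i < r) j (c 0 i) *: e i)) /\
  (forall w, L w -> exists! c : 'rV[S]_r, w = \sum_(i < r) j (c 0 i) *: e i).

(* The vector d(L1, L2), with logarithms in base q. The vectors satisfying the
   condition below form a singleton when L1 and L2 are lattices over the
   valuation ring of v. *)
Definition relative_position (R : realType) (q : nat) (S : comNzRingType)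
    (F : fieldType) (v : absval R F) (j : {rmorphism S -> F})
    (V : lmodType F) (r : nat) (L1 L2 : set V) : 'rV[R]_r :=
  xget 0 [set d : 'rV[R]_r | exists (e : 'I_r -> V) (x : 'I_r -> F),
    [/\ lattice_basis j L1 e,
        forall i, x i != 0,
        forall i k : 'I_r, (i <= k)%N -> v (x k) <= v (x i),
        lattice_basis j L2 (fun i => x i *: e i) &
        forall i, d 0 i = ln (v (x i)) / ln q%:R]].

Definition Rge (R : realType) (r : nat) : set 'rV[R]_r :=
  [set d : 'rV[R]_r | forall i k : 'I_r, (i <= k)%N -> d 0 k <= d 0 i].

Definition Zge (R : realType) (r : nat) : set 'rV[R]_r :=
  [set d : 'rV[R]_r | Rge d /\ forall i, exists n : int, d 0 i = n%:~R].

Definition type_le (R : realType) (r : nat) (d d' : 'rV[R]_r) : Prop :=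
  (forall s : nat, (s <= r)%N ->
     \sum_(i < r | (i < s)%N) d 0 i <= \sum_(i < r | (i < s)%N) d' 0 i) /\
  \sum_(i < r) d 0 i = \sum_(i < r) d' 0 i.

Definition type_le_in (R : realType) (r : nat) (X : set 'rV[R]_r)
  (d d' : 'rV[R]_r) : Prop := [/\ X d, X d' & type_le d d'].

(* Completion of Q at the principal ideal generated by x: Q/x^n = C/x^n for
   all n, and C is x-adically separated and complete. *)
Definition is_completion (Q C : comNzRingType) (x : Q)
    (j : {rmorphism Q -> C}) : Prop :=
  [/\ forall n a, (exists c, j a = j x ^+ n * c) -> exists b, a = x ^+ n * b,
      forall n c, exists a d, c = j a + j x ^+ n * d,
      forall c, (forall n, exists d, c = j x ^+ n * d) -> c = 0 &
      forall u : nat -> C,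
        (forall n, exists d, u n.+1 - u n = j x ^+ n * d) ->
        exists l, forall n, exists d, u n - l = j x ^+ n * d].

(* [v] is the absolute value of the discrete valuation ring [O] with
   uniformizer [x], normalized by |x| = 1/q. *)
Definition normalized_absval (R : realType) (q : nat) (O : idomainType) (x : O)
    (v : absval R {fraction O}) : Prop :=
  v (tofrac x) = q%:R^-1 /\
  forall y, v y <= 1 <-> exists a : O, y = tofrac a.

Definition principal (A : comNzRingType) (x : A) : set A :=
  [set a | exists b, a = b * x].

Record bkf_setting (R : realType) := BKFSetting {
  bkE : local_field R;
  bkK : perfectoid_ext bkE;
  bkKb : tilt (pf_v bkK) (lf_p bkE);
  (* O_E -> F_q -> O_K^flat *)
  bk_str : {rmorphism valring (lf_v bkE) -> valring (tilt_v bkKb)};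
  bk_strP : forall c,
    pf_v bkK (sharp (\val (bk_str c)) - pf_in bkK (\val c)) < 1;
  bkF : fieldType;
  bk_res : {rmorphism valring (tilt_v bkKb) -> bkF};
  bk_resP : is_residue_map bk_res;
  bkA : witt_vectors (lf_pi bkE) bk_str;
  bkOL : witt_vectors (lf_pi bkE) (bk_res \o bk_str);
  (* W_(O_E) of the residue map O_K^flat -> F *)
  bk_toOL : {rmorphism bkA -> bkOL};
  bk_toOL_str : forall c, bk_toOL (witt_str bkA c) = witt_str bkOL c;
  bk_toOL_red : forall a,
    witt_red bkOL (bk_toOL a) = bk_res (witt_red bkA a);
  bk_phi : {rmorphism bkA -> bkA};
  bk_phi_str : forall c, bk_phi (witt_str bkA c) = witt_str bkA c;
  bk_phi_red : forall a,
    witt_red bkA (bk_phi a) = witt_red bkA a ^+ lf_q bkE;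
  (* Teichmueller lift *)
  bk_teich : valring (tilt_v bkKb) -> bkA;
  bk_teichM : {morph bk_teich : x y / x * y};
  bk_teich_red : forall x, witt_red bkA (bk_teich x) = x;
  bk_theta : {rmorphism bkA -> valring (pf_v bkK)};
  bk_theta_str : forall c,
    \val (bk_theta (witt_str bkA c)) = pf_in bkK (\val c);
  bk_theta_teich : forall x,
    \val (bk_theta (bk_teich x)) = sharp (\val x);
  bk_xi : bkA;
  bk_xiP : forall a, bk_theta a = 0 <-> principal bk_xi a;
  bk_vb_norm :
    (lf_q bkE)%:R *
      tilt_v bkKb (\val (witt_red bkA bk_xi) ^+ lf_q bkE) = 1;
  bk_vL : absval R {fraction bkOL};
  bk_vLP : normalized_absval (lf_q bkE) (witt_str bkOL (lf_pi bkE)) bk_vL;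
  (* completion of the local ring of A[1/pi] at (xi') *)
  bkBdR : idomainType;
  bk_toBdR :
    let Api := loc [set witt_str bkA (lf_pi bkE)] in
    let x : Api := loc_in _ (bk_phi bk_xi) in
    {rmorphism loc (~` principal x) -> bkBdR};
  bk_toBdRP : is_completion (loc_in _ (loc_in _ (bk_phi bk_xi))) bk_toBdR;
  bk_vdR : absval R {fraction bkBdR};
  bk_vdRP : normalized_absval (lf_q bkE)
    (bk_toBdR (loc_in _ (loc_in _ (bk_phi bk_xi)))) bk_vdR
}.

Section BKF.
Variables (R : realType) (D : bkf_setting R).

Definition bk_xi' : bkA D := bk_phi D (bk_xi D).

Definition A_to_BdR : {rmorphism bkA D -> bkBdR D} :=
  bk_toBdR D \o (@loc_in _ _ \o @loc_in _ _).

Definition A_inv_xi' : idomainType := loc [set bk_xi'].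
Definition to_inv_xi' : {rmorphism bkA D -> A_inv_xi'} :=
  @loc_in _ [set bk_xi'].

Record bkf_module (r : nat) := BKFModule {
  bkf_M :> lmodType (bkA D);
  bkf_free : exists e : 'I_r -> bkf_M, is_basis e;
  bkf_phi : {linear base_change to_inv_xi' (base_change (bk_phi D) bkf_M) ->
                    base_change to_inv_xi' bkf_M};
  bkf_phi_bij : bijective bkf_phi
}.

Section HodgeType.
Variables (r : nat) (M : bkf_module r).
Variables (S : comNzRingType) (F : fieldType).
Variables (i : {rmorphism bkA D -> S}) (j : {rmorphism S -> F}).
Variable (v : absval R F).

Local Notation phiM := (base_change (bk_phi D) M).
Local Notation g := (j \o i).

Definition to_generic (N : lmodType (bkA D)) :
  base_change i N -> base_change g N :=
  tens_lift (fun s n => tens g (j s) n).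

Definition from_inv_xi' (N : lmodType (bkA D)) :
  base_change to_inv_xi' N -> base_change g N :=
  tens_lift (fun s n => tens g (loc_lift g s) n).

(* the base change to F of phi_M *)
Definition phi_generic : base_change g phiM -> base_change g M :=
  tens_lift (fun s n => s *: from_inv_xi' (bkf_phi M (tens to_inv_xi' 1 n))).

Definition hodge_type : 'rV[R]_r :=
  relative_position (lf_q (bkE D)) v j r
    (range (@to_generic M)) (phi_generic @` range (@to_generic phiM)).

End HodgeType.

Definition tH_BdR (r : nat) (M : bkf_module r) : 'rV[R]_r :=
  hodge_type M A_to_BdR (@tofrac (bkBdR D)) (bk_vdR D).

Definition tH_OL (r : nat) (M : bkf_module r) : 'rV[R]_r :=
  hodge_type M (bk_toOL D) (@tofrac (bkOL D)) (bk_vL D).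

Definition tH_Ob (r : nat) (M : bkf_module r) : 'rV[R]_r :=
  hodge_type M (witt_red (bkA D))
    (\val : valring (tilt_v (bkKb D)) -> bkKb D) (tilt_v (bkKb D)).

End BKF.

(* Main.v *)
(** A matrix of the Frobenius of M lies in GL_r(A[1/xi']).  Over each of the
    three valuation rings S, the sum of the s largest entries of the relative
    position is the logarithm of the largest absolute value of an s x s minor of
    this matrix.  It therefore suffices to compare absolute values on A[1/xi']:
    if a in A has absolute value at most q^-n on B'_dR, then xi'^n divides a in
    A, because (xi') is a prime ideal of A that does not contain pi; and xi' has
    absolute value 1/q both on L and on K^flat, so |a| <= q^-n there as well.
    Applied to the determinant and to its inverse, the comparison gives the
    equality of the full sums.  That xi' maps to a uniformizer of O_L follows
    from the element pi - [x] w of ker theta, where |x^sharp| = |pi|: since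
    x is the p-th power of an element of absolute value < 1, pi^2 divides the
    image of [x] in O_L. *)

Require Import Defs.
From HB Require Import structures.
From mathcomp Require Import all_boot all_order all_algebra all_fingroup
  all_field.
From mathcomp Require Import fraction generic_quotient.
From mathcomp Require Import boolp classical_sets reals exp.
Set Implicit Arguments.
Unset Strict Implicit.
Unset Printing Implicit Defensive.
Import Order.TTheory GRing.Theory Num.Theory.
Local Open Scope ring_scope.
Local Open Scope classical_set_scope.
Local Open Scope quotient_scope.

(** * Minors and elementary divisors of matrices over a valued field *)

(** On A the absolute value of B'_dR is the xi'-adic one, hence the largest among the absolute
    values that are at most 1 on A and equal to 1/q at xi'. This is why t_H(M ⊗ E) is the upper
    bound in both inequalities and why one comparison serves both L and K^flat. The comparison is
    sharp because B'_dR is discretely valued: |a| is a power of q there, so nothing is lost in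
    passing from |a| to divisibility by a power of xi'. The valuation of K^flat is not discrete, so
    elementary divisors cannot be read off from powers of a uniformizer; pivoting on an entry of
    largest absolute value works for all three rings alike. [relative_position] chooses some vector
    satisfying its condition and returns 0 if there is none. The existence of adapted bases
    therefore has to be established before anything can be said about a Hodge type; the bounds on
    minors then apply to whichever vector was chosen. *)

Lemma det_mulmx_rowsub (A : comPzRingType) (s r : nat) (X : 'M[A]_(s, r))
    (Y : 'M[A]_(r, s)) :
  \det (X *m Y) =
    \sum_(f : {ffun 'I_s -> 'I_r}) (\prod_i X i (f i)) * \det (rowsub f Y).
Proof.
rewrite /determinant.
(* Distributing the product over rows gives the Cauchy-Binet formula in unsorted form, over all maps
   f rather than increasing ones. An ultrametric bound on each term is all that is drawn from it, so
   terms need not be grouped. *)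
transitivity (\sum_(f : {ffun 'I_s -> 'I_r}) \sum_(t : 'S_s)
    (-1) ^+ t * \prod_i (X i (f i) * Y (f i) (t i))).
  rewrite exchange_big; apply: eq_bigr => /= t _; rewrite -big_distrr /=.
  congr (_ * _).
  rewrite -(bigA_distr_bigA (fun i j => X i j * Y j (t i))) /=.
  by apply: eq_bigr => i _; rewrite mxE.
apply: eq_bigr => f _; rewrite big_distrr /=; apply: eq_bigr => t _.
rewrite big_split /= mulrCA; congr (_ * (_ * _)).
by apply: eq_bigr => i _; rewrite mxE.
Qed.

Lemma prod_inj_le (R : realDomainType) (r : nat) (y : 'I_r -> R)
    (s : nat) (h : 'I_s -> 'I_r) :
  (forall i, 0 <= y i) -> (forall i k : 'I_r, (i <= k)%N -> y k <= y i) ->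
  injective h -> \prod_i y (h i) <= \prod_(i < r | (i < s)%N) y i.
Proof.
move=> y0 ynondec; elim: s h => [|s ih] h hinj.
  by rewrite big_ord0 big_pred0.
(* By the pigeonhole principle one of the s + 1 distinct indices is at least s; its factor is at
   most the factor at s, and the induction hypothesis handles the others. *)
have [i0 hi0] : exists i0, (s <= h i0)%N.
  apply/not_existsP => hs.
  have lt i : (h i < s)%N by rewrite ltnNge; apply/negP/hs.
  have : injective (fun i => Ordinal (lt i)).
    by move=> i j [] /val_inj/hinj.
  by move=> /leq_card; rewrite !card_ord ltnn.
have sr : (s < r)%N by apply: leq_ltn_trans hi0 (ltn_ord _).
rewrite (bigD1_ord i0)//= (bigD1 (Ordinal sr))//=.
rewrite (eq_bigl (fun i : 'I_r => (i < s)%N)); last first.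
  by move=> i; rewrite -val_eqE /= ltnS [RHS]ltn_neqAle andbC.
apply: ler_pM => //; first by apply: prodr_ge0.
  exact: ynondec.
by apply: ih => i j /hinj/lift_inj.
Qed.

Section ValuedMatrices.
Variables (R : realType) (F : fieldType) (v : absval R F).

(* The axioms of [absval] also admit the constant function 1. *)
Lemma absval0 (x : F) : v x != 1 -> v 0 = 0.
Proof.
move=> vx; have : v 0 * (1 - v x) = 0.
  by rewrite mulrBr mulr1 -absvalM mul0r subrr.
by move/eqP; rewrite mulf_eq0 subr_eq0 [1 == _]eq_sym (negbTE vx) orbF => /eqP.
Qed.

Hypothesis v0 : v 0 = 0.

Lemma absval_gt0 x : x != 0 -> 0 < v x.
Proof.
rewrite lt_def absval_ge0 andbT; apply: contra => /eqP h.
by apply/eqP/(absval_eq0 h).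
Qed.

Lemma absvalX x n : v (x ^+ n) = v x ^+ n.
Proof. by elim: n => [|n ih]; rewrite ?expr0 ?absval1// !exprS absvalM ih. Qed.

Lemma absvalV x : v x^-1 = (v x)^-1.
Proof.
have [->|x0] := eqVneq x 0; first by rewrite invr0 v0 invr0.
have vx : v x != 0 by rewrite gt_eqF// absval_gt0.
by apply: (mulfI vx); rewrite -absvalM !divff ?absval1.
Qed.

Lemma absval_prod I (s : seq I) (P : pred I) (f : I -> F) :
  v (\prod_(i <- s | P i) f i) = \prod_(i <- s | P i) v (f i).
Proof. exact: (big_morph v (absvalM v) (absval1 v)). Qed.

Lemma absval_sum_le I (s : seq I) (P : pred I) (f : I -> F) C :
  0 <= C -> (forall i, P i -> v (f i) <= C) -> v (\sum_(i <- s | P i) f i) <= C.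
Proof.
move=> C0 h; elim/big_ind: _ => //; first by rewrite v0.
move=> x y hx hy; apply: le_trans (absvalD _ _ _) _.
by rewrite ge_max hx hy.
Qed.

Lemma absval_sign n : v ((-1) ^+ n) = 1.
Proof. by rewrite absvalX absvalN1 expr1n. Qed.

(** Rows and columns are selected by arbitrary maps, to match the unsorted Cauchy-Binet sum. *)
Definition minors_le (m n s : nat) (C : R) (P : 'M[F]_(m, n)) : Prop :=
  forall f g, v (\det (mxsub f g P : 'M_s)) <= C.

Local Notation integral := (mxOver (integral_elt v)).

Lemma integralP m n (X : 'M[F]_(m, n)) :
  X \is a integral <-> forall i j, v (X i j) <= 1.
Proof.
by split=> [/mxOverP h i j|h]; [have := h i j|apply/mxOverP => i j; have
  := h i j].
Qed.

Lemma minors_leT m n s C (P : 'M[F]_(m, n)) :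
  minors_le s C P -> minors_le s C P^T.
Proof. by move=> h f g; rewrite -trmx_mxsub det_tr. Qed.

(** By Cauchy-Binet a minor of the product is a combination of minors of P whose coefficients are
    products of entries of X, so the ultrametric inequality applies. *)
Lemma minors_leMl m n p s C (X : 'M[F]_(m, n)) (P : 'M_(n, p)) :
  X \is a integral -> 0 <= C -> minors_le s C P -> minors_le s C (X *m P).
Proof.
move=> /integralP hX C0 h f g.
rewrite mxsub_mul det_mulmx_rowsub; apply: absval_sum_le => // k _.
rewrite absvalM absval_prod -[C]mul1r ler_pM ?absval_ge0//.
- by rewrite prodr_ge0// => i _; apply: absval_ge0.
- by apply: prodr_ile1 => i _; rewrite absval_ge0 mxE hX.
- by rewrite -mxsub_comp; apply: h.
Qed.

Lemma minors_leMr m n p s C (X : 'M[F]_(n, p)) (P : 'M_(m, n)) :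
  X \is a integral -> 0 <= C -> minors_le s C P -> minors_le s C (P *m X).
Proof.
move=> hX C0 h; rewrite -[_ *m _]trmxK trmx_mul; apply: minors_leT.
apply: minors_leMl => //; last exact: minors_leT.
by apply/integralP => i j; rewrite mxE; move/integralP: hX.
Qed.

Lemma minors_le_diag r s (x : 'I_r -> F) :
  (forall i k : 'I_r, (i <= k)%N -> v (x k) <= v (x i)) ->
  minors_le s (\prod_(i < r | (i < s)%N) v (x i)) (diag_mx (\row_i x i)).
Proof.
move=> xdec f g; have C0 : 0 <= \prod_(i < r | (i < s)%N) v (x i).
  by apply: prodr_ge0 => i _; apply: absval_ge0.
(* For injective f, a term of the Leibniz expansion is zero or a product of divisors at s distinct
   indices; otherwise two rows coincide and the minor vanishes. *)
case: (pselect (injective f)) => [finj|fninj].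
  apply: absval_sum_le => // t _; rewrite absvalM absval_sign mul1r absval_prod.
  apply: le_trans (prod_inj_le _ xdec finj); last first.
    by move=> i; apply: absval_ge0.
  apply: ler_prod => i _; rewrite absval_ge0 !mxE /=.
  by case: eqP => _; rewrite ?mulr1n ?mulr0n ?v0 ?absval_ge0.
have [i [j [ij fij]]] : exists i j, i != j /\ f i = f j.
  apply/not_existsP => h; apply: fninj => i j fij.
  by apply/eqP/negPn/negP => ij; apply: (h i); exists j.
rewrite (determinant_alternate ij) ?v0// => k.
by rewrite !mxE fij.
Qed.

Lemma minors_le_diagP r s (x : 'I_r -> F) C :
  (s <= r)%N -> minors_le s C (diag_mx (\row_i x i)) ->
  \prod_(i < r | (i < s)%N) v (x i) <= C.
Proof.
move=> sr /(_ (widen_ord sr) (widen_ord sr)).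
rewrite [mxsub _ _ _](_ : _ = diag_mx (\row_(i < s) x (widen_ord sr i))).
  rewrite det_diag absval_prod big_ord_narrow.
  by under eq_bigr do rewrite mxE.
by apply/matrixP => i j; rewrite !mxE.
Qed.

(** This is GL_n of the valuation ring, kept inside matrices over F with an explicit integral
    inverse. *)
Definition integral_unit n (U : 'M[F]_n) : Prop :=
  exists U', [/\ U \is a integral, U' \is a integral,
                 U *m U' = 1%:M & U' *m U = 1%:M].

Lemma integral_unit1 n : integral_unit (1%:M : 'M_n).
Proof.
exists 1%:M; rewrite mulmx1.
by split=> //; rewrite mxOver_scalar ?rpred0 ?rpred1.
Qed.

Lemma integral_unitM n (U W : 'M_n) :
  integral_unit U -> integral_unit W -> integral_unit (U *m W).
Proof.
move=> [U' [iU iU' UU' U'U]] [W' [iW iW' WW' W'W]]; exists (W' *m U').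
split; rewrite ?mxOverM//.
  by rewrite mulmxA -(mulmxA U) WW' mulmx1.
by rewrite mulmxA -(mulmxA W') U'U mulmx1.
Qed.

Lemma integral_unit_perm n (s : 'S_n) : integral_unit (perm_mx s).
Proof.
have i t : (perm_mx t : 'M_n) \is a integral.
  by apply/mxOverP => i j; rewrite !mxE; case: eqP; rewrite ?rpred0 ?rpred1.
by exists (perm_mx s^-1); split=> //; rewrite -perm_mxM ?mulgV ?mulVg perm_mx1.
Qed.

Lemma integral_block m1 m2 n1 n2 (A : 'M[F]_(m1, n1)) (B : 'M_(m1, n2))
    (C : 'M_(m2, n1)) (D : 'M_(m2, n2)) :
  A \is a integral -> B \is a integral -> C \is a integral ->
  D \is a integral -> block_mx A B C D \is a integral.
Proof.
move=> /mxOverP iA /mxOverP iB /mxOverP iC /mxOverP iD; apply/mxOverP => i j.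
by rewrite !mxE; case: splitP => i' _; rewrite mxE; case: splitP => j' _.
Qed.

(** The bound C serves the induction: taken to be the absolute value of the pivot, it makes the
    divisors of the remaining block come after the pivot. *)
Definition has_smith_form n (C : R) (P : 'M[F]_n) : Prop :=
  exists U W x, [/\ integral_unit U, integral_unit W,
    forall i k : 'I_n, (i <= k)%N -> v (x k) <= v (x i),
    P = U *m diag_mx (\row_i x i) *m W & forall i, v (x i) <= C].

Lemma has_smith_formM n C (P U W : 'M[F]_n) :
  integral_unit U -> integral_unit W -> has_smith_form C (U *m P *m W) ->
  has_smith_form C P.
Proof.
move=> [U' [iU iU' UU' U'U]] [W' [iW iW' WW' W'W]].
move=> [X [Y [x [iX iY xdec eP xC]]]].
exists (U' *m X), (Y *m W'), x; split=> //.
- by apply: integral_unitM => //; exists U.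
- by apply: integral_unitM => //; exists W.
- rewrite !mulmxA -(mulmxA U') -(mulmxA U' (X *m _)) -eP.
  by rewrite !mulmxA U'U mul1mx -mulmxA WW' mulmx1.
Qed.

Lemma smith_form n C (P : 'M[F]_n) :
  (forall i j, v (P i j) <= C) -> has_smith_form C P.
Proof.
elim: n C P => [|n ih] C P PC.
  exists 1%:M, 1%:M, (fun=> 0); split=> //; try exact: integral_unit1.
  - by apply/matrixP => - [].
  - by case.
(* Pivoting on an entry of maximal absolute value keeps the elimination
   integral and sorts the elementary divisors. *)
pose k := [arg max_(k > (ord0, ord0)) v (P k.1 k.2)]%O.
have kmax i j : v (P i j) <= v (P k.1 k.2).
  by rewrite /k; case: arg_maxP => // l _ /(_ (i, j) isT).
apply: (has_smith_formM (integral_unit_perm (tperm ord0 k.1))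
                        (integral_unit_perm (tperm ord0 k.2))).
rewrite -row_permE -[perm_mx (tperm _ k.2)]/(tperm_mx _ _) -xcolE.
set P' : 'M_(1 + n) := xcol _ _ _.
have P'E i j : exists i' j', P' i j = P i' j'.
  by exists (tperm ord0 k.1 i), (tperm ord0 k.2 j); rewrite !mxE.
have P'0 : P' 0 0 = P k.1 k.2 by rewrite !mxE !tpermL.
have {}kmax i j : v (P' i j) <= v (P' 0 0).
  by have [i' [j' ->]] := P'E i j; rewrite P'0.
have P'C : v (P' 0 0) <= C by rewrite P'0.
clearbody P'; move: P' kmax P'C {P'E P'0 k PC P} => P kmax PC.
set a := P 0 0 in kmax PC.
(* The pivot may be 0. All entries are then 0, and the convention that division by 0 gives 0
   preserves both conclusions. *)
have adiv y : v y <= v a -> v (y / a) <= 1 /\ y / a * a = y.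
  have [a0|a0] := eqVneq a 0.
    rewrite a0 v0 => y0; have /absval_eq0-> : v y = 0.
      by apply/eqP; rewrite eq_le y0 absval_ge0.
    by rewrite mul0r mulr0 v0.
  by move=> ya; rewrite divfK// absvalM absvalV ler_pdivrMr ?mul1r ?absval_gt0.
pose b := ursubmx P; pose c := dlsubmx P; pose D := drsubmx P.
have Pul : ulsubmx P = a%:M.
  apply/matrixP => i j; rewrite !ord1 !mxE mulr1n.
  by congr (P _ _); apply/val_inj.
pose c' := a^-1 *: c; pose b' := a^-1 *: b.
have ab' : a *: b' = b.
  apply/matrixP => i j; rewrite !mxE mulrC mulrAC mulrC mulrA.
  by have [] := adiv _ (kmax (lshift n i) (rshift 1 j)).
have ac' : c' *m a%:M = c.
  apply/matrixP => i j; rewrite mul_mx_scalar !mxE mulrC [_^-1 * _]mulrC.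
  by have [] := adiv _ (kmax (rshift 1 i) (lshift n j)).
have ic' : c' \is a integral.
  apply/integralP => i j; rewrite !mxE mulrC.
  by have [] := adiv _ (kmax (rshift 1 i) (lshift n j)).
have ib' : b' \is a integral.
  apply/integralP => i j; rewrite !mxE mulrC.
  by have [] := adiv _ (kmax (lshift n i) (rshift 1 j)).
(* The entries of the Schur complement are still bounded by |a|, since c' is integral and the
   entries of b and D are bounded by |a|. *)
have [|U [W [x [iU iW xdec eD xa]]]] := ih (v a) (D - c' *m b).
  move=> i j; rewrite mxE; apply: le_trans (absvalD _ _ _) _.
  rewrite !mxE absvalN ge_max kmax/=.
  apply: absval_sum_le => [|l _]; first exact: absval_ge0.
  rewrite absvalM -[leRHS]mul1r ler_pM ?absval_ge0//.
  - by move/integralP: ic'.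
  - by rewrite /b !mxE kmax.
have i1 m : 1%:M \is a @mxOver m m _ (integral_elt v).
  by rewrite mxOver_scalar ?rpred0 ?rpred1.
have i0 m1 m2 : 0 \is a @mxOver m1 m2 _ (integral_elt v).
  by rewrite rpred0.
have iB (V : 'M_n) : integral_unit V ->
    @integral_unit (1 + n) (block_mx 1%:M 0 0 V).
  move=> [V' [iV iV' VV' V'V]]; exists (block_mx 1%:M 0 0 V').
  rewrite !integral_block ?i0// !mulmx_block !mul0mx !mulmx0 !addr0 !add0r.
  by rewrite !mulmx1 VV' V'V -scalar_mx_block.
change (@has_smith_form (1 + n) C P).
exists (block_mx 1%:M 0 c' 1%:M *m block_mx 1%:M 0 0 U).
exists (block_mx 1%:M 0 0 W *m block_mx 1%:M b' 0 1%:M).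
exists (fun i => if unlift ord0 i is Some i' then x i' else a); split.
- apply: integral_unitM (iB _ iU); exists (block_mx 1%:M 0 (- c') 1%:M).
  rewrite !integral_block ?rpredN ?i0// !mulmx_block !mul0mx !mulmx0 !addr0.
  by rewrite !add0r !mul1mx !mulmx1 subrr addNr -scalar_mx_block.
- apply: integral_unitM (iB _ iW) _; exists (block_mx 1%:M (- b') 0 1%:M).
  rewrite !integral_block ?rpredN ?i0// !mulmx_block !mul0mx !mulmx0 !addr0.
  by rewrite !add0r !mul1mx !mulmx1 subrr addNr -scalar_mx_block.
- move=> i l; case: unliftP => [l' ->|->]; case: unliftP => [i' ->|->] //=.
  exact: xdec.
- rewrite [diag_mx _](_ : _ = block_mx a%:M 0 0 (diag_mx (\row_i x i))).
    rewrite -!mulmxA ![_ *m (block_mx _ _ _ _ *m block_mx _ _ _ _)]mulmxA.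
    rewrite !mulmx_block !mul0mx !mulmx0 !addr0 !add0r !mul1mx !mulmx1.
    rewrite ac' mul_scalar_mx ab' mulmx0 mul0mx !addr0 add0r mulmxA -eD.
    by rewrite addrC subrK -Pul submxK.
  rewrite -diag_const_mx -diag_mx_row; congr diag_mx.
  apply/rowP => i; rewrite !mxE; case: split_ordP => j ->; rewrite !mxE.
    by case: unliftP => // k /(congr1 val); rewrite ord1.
  by rewrite rshift1 liftK.
- by move=> i; case: unliftP => [i' _|_] //; apply: le_trans PC.
Qed.

End ValuedMatrices.

(** * Base change *)

Section BaseChange.
Variables (A S : comNzRingType) (f : {rmorphism A -> S}) (M : lmodType A).

Lemma base_change_ind (P : base_change f M -> Prop) :
  (forall x y, P x -> P y -> P (x + y)) -> P 0 ->
  (forall s m, P (tens f s m)) -> forall x, P x.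
Proof.
move=> PD P0 Pt; elim/quotW => u; elim: u => [|[s m] u ih]; first exact: P0.
have -> : \pi_(base_change f M) ((s, m) :: u) =
    tens f s m + \pi_(base_change f M) u.
  by rewrite -[RHS]/(tens_add _ _) tens_addE.
exact: PD.
Qed.

Lemma tensDl s t (m : M) : tens f (s + t) m = tens f s m + tens f t m.
Proof.
rewrite -[RHS]/(tens_add _ _) tens_addE; apply/tensP; exact: TensDl.
Qed.

Lemma tensDr s (m n : M) : tens f s (m + n) = tens f s m + tens f s n.
Proof.
rewrite -[RHS]/(tens_add _ _) tens_addE; apply/tensP; exact: TensDr.
Qed.

Lemma tens_bal s a (m : M) : tens f (s * f a) m = tens f s (a *: m).
Proof. by apply/tensP; apply: TensBal. Qed.

Lemma tens0l (m : M) : tens f 0 m = 0.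
Proof. by apply/tensP; apply: Tens0. Qed.

Lemma tensZ c s (m : M) : c *: tens f s m = tens f (c * s) m.
Proof. by rewrite -[LHS]/(tens_scale _ _) tens_scaleE. Qed.

Lemma tensE s (m : M) : tens f s m = s *: tens f 1 m.
Proof. by rewrite tensZ mulr1. Qed.

Lemma tens0r s : tens f s (0 : M) = 0.
Proof. by rewrite -(scale0r (0 : M)) -tens_bal rmorph0 mulr0 tens0l. Qed.

Lemma tens_sum s r (c : 'I_r -> M) :
  tens f s (\sum_i c i) = \sum_i tens f s (c i).
Proof. by apply: (big_morph (tens f s) (tensDr s) (tens0r s)). Qed.

Section Lift.
Variables (N : zmodType) (b : S -> M -> N).
Hypotheses (bDl : forall m, {morph b^~ m : s t / s + t})
           (bDr : forall s, {morph b s : m n / m + n})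
           (b_bal : forall s a m, b (s * f a) m = b s (a *: m)).

Lemma tens_lift_eq u w : tens_eq f u w ->
  \sum_(y <- u) b y.1 y.2 = \sum_(y <- w) b y.1 y.2.
Proof.
have b0 m : b 0 m = 0 by apply: (addrI (b 0 m)); rewrite -bDl !addr0.
elim=> {u w} [//|//|u w x _ -> _ ->//|u u' w w' _ h _ h'|u w|m|s t m|s m n|
             s a m].
- by rewrite !big_cat /= h h'.
- by rewrite !big_cat /= addrC.
- by rewrite big_seq1 big_nil b0.
- by rewrite big_seq1 big_cons big_seq1 bDl.
- by rewrite big_seq1 big_cons big_seq1 bDr.
- by rewrite !big_seq1 b_bal.
Qed.

Lemma tens_lift_tens s m : tens_lift b (tens f s m) = b s m.
Proof. by rewrite [LHS](tens_lift_eq (tens_repr f _)) big_seq1. Qed.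

Lemma tens_liftD : {morph tens_lift b (f := f) : x y / x + y}.
Proof.
move=> x y; rewrite -[x + y]/(tens_add x y) [LHS](tens_lift_eq (tens_repr f _)).
by rewrite big_cat.
Qed.

Lemma tens_lift0 : tens_lift b (0 : base_change f M) = 0.
Proof.
by apply: (addrI (tens_lift b (0 : base_change f M)));
  rewrite -tens_liftD !addr0.
Qed.

Lemma tens_lift_sum r (x : 'I_r -> base_change f M) :
  tens_lift b (\sum_i x i) = \sum_i tens_lift b (x i).
Proof. exact: (big_morph _ tens_liftD tens_lift0). Qed.

End Lift.

Lemma base_change_basis r (e : 'I_r -> M) :
  is_basis e -> is_basis (fun i => tens f 1 (e i)).
Proof.
move=> he.
pose co m := projT1 (cid (he m)).
have coP m : m = \sum_i co m 0 i *: e i by rewrite /co; case: cid => c [].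
have coU (c : 'rV[A]_r) : co (\sum_i c 0 i *: e i) = c.
  by rewrite /co; case: cid => c' [h hu] /=; apply: hu.
have coD m n : co (m + n) = co m + co n.
  rewrite -[RHS]coU; congr co; rewrite {1}[m]coP {1}[n]coP -big_split /=.
  by apply: eq_bigr => i _; rewrite mxE scalerDl.
have coZ a m : co (a *: m) = a *: co m.
  rewrite -[RHS]coU; congr co; rewrite {1}[m]coP scaler_sumr.
  by apply: eq_bigr => i _; rewrite mxE scalerA.
(* The coordinate map of the base change sends s ⊗ m to s times the image of the coordinates of m.
   It is balanced, and evaluating it on a combination recovers the coefficients, which gives
   uniqueness. *)
pose b (s : S) (m : M) : 'rV[S]_r := \row_i (s * f (co m 0 i)).
have bDl m : {morph b^~ m : s t / s + t}.
  by move=> s t; apply/rowP => i; rewrite !mxE mulrDl.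
have bDr s : {morph b s : m n / m + n}.
  by move=> m n; apply/rowP => i; rewrite !mxE coD mxE rmorphD mulrDr.
have bbal s a m : b (s * f a) m = b s (a *: m).
  by apply/rowP => i; rewrite !mxE coZ mxE rmorphM mulrA.
move=> x; suff [c ->] : exists c : 'rV[S]_r, x = \sum_i c 0 i *: tens f 1 (e i).
  have liftE (d : 'rV[S]_r) : tens_lift b (\sum_i d 0 i *: tens f 1 (e i)) = d.
    rewrite tens_lift_sum//; apply/rowP => k; rewrite summxE (bigD1 k)//= big1.
      rewrite tensZ mulr1 tens_lift_tens// mxE addr0.
      have -> : e k = \sum_i (delta_mx 0 k : 'rV[A]_r) 0 i *: e i.
        rewrite (bigD1 k)//= big1 ?addr0 ?mxE ?eqxx ?scale1r// => j jk.
        by rewrite mxE (negbTE jk) scale0r.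
      by rewrite coU mxE !eqxx rmorph1 mulr1.
    move=> i ik; rewrite tensZ mulr1 tens_lift_tens// mxE.
    have -> : e i = \sum_j (delta_mx 0 i : 'rV[A]_r) 0 j *: e j.
      rewrite (bigD1 i)//= big1 ?addr0 ?mxE ?eqxx ?scale1r// => j ji.
      by rewrite mxE (negbTE ji) scale0r.
    by rewrite coU mxE eqxx eq_sym (negbTE ik) rmorph0 mulr0.
  by exists c; split=> // d /(congr1 (tens_lift b)); rewrite !liftE.
elim/base_change_ind: x => [x y [c ->] [d ->]||s m].
- exists (c + d); rewrite -big_split; apply: eq_bigr => i _.
  by rewrite mxE scalerDl.
- by exists 0; rewrite big1// => i _; rewrite mxE scale0r.
- exists (b s m); rewrite {1}[m]coP tens_sum; apply: eq_bigr => i _.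
  by rewrite -tens_bal tensE mxE.
Qed.

End BaseChange.
Arguments base_change_basis {A S} f {M r e}.

(** * Lattices and relative positions *)

Section Combinations.
Variables (A : comNzRingType) (V : lmodType A) (r : nat) (E : 'I_r -> V).

Definition comb (c : 'rV[A]_r) : V := \sum_i c 0 i *: E i.

Lemma combD : {morph comb : c d / c + d}.
Proof.
move=> c d; rewrite -big_split; apply: eq_bigr => i _.
by rewrite mxE scalerDl.
Qed.

Lemma combZ a c : comb (a *: c) = a *: comb c.
Proof. by rewrite scaler_sumr; apply: eq_bigr => i _; rewrite mxE scalerA. Qed.

Lemma comb0 : comb 0 = 0.
Proof. by rewrite /comb big1// => i _; rewrite mxE scale0r. Qed.

Lemma comb_sum n (c : 'I_n -> 'rV[A]_r) : comb (\sum_i c i) = \sum_i comb (c i).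
Proof. exact: (big_morph comb combD comb0). Qed.

Lemma comb_mulmx n (c : 'rV[A]_n) (B : 'M[A]_(n, r)) :
  comb (c *m B) = \sum_i c 0 i *: comb (row i B).
Proof.
by rewrite mulmx_sum_row comb_sum; apply: eq_bigr => i _; rewrite combZ.
Qed.

Lemma comb_delta i : comb (delta_mx 0 i) = E i.
Proof.
rewrite /comb (bigD1 i)//= big1 ?addr0 ?mxE ?eqxx ?scale1r// => j ji.
by rewrite mxE (negbTE ji) scale0r.
Qed.

Lemma comb_row1 i : comb (row i 1%:M) = E i.
Proof. by rewrite rowE mulmx1 comb_delta. Qed.

Lemma comb_inj : is_basis E -> injective comb.
Proof.
move=> hE c d cd; have [x [_ hx]] := hE (comb c).
by rewrite -[LHS]hx//; apply: hx.
Qed.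

Lemma comb_surj w : is_basis E -> exists c, w = comb c.
Proof. by move=> /(_ w) [c [? _]]; exists c. Qed.

Lemma comb_families n (e : 'I_n -> V) : is_basis E ->
  exists B : 'M[A]_(n, r), forall i, e i = comb (row i B).
Proof.
move=> hE; have /choice[c hc] i := comb_surj (e i) hE.
by exists (\matrix_i c i) => i; rewrite rowK.
Qed.

End Combinations.

Lemma linear_comb (A : comNzRingType) (V W : lmodType A) (r : nat)
    (E : 'I_r -> V) (h : V -> W) :
  {morph h : x y / x + y} -> (forall a x, h (a *: x) = a *: h x) ->
  forall c, h (comb E c) = comb (fun i => h (E i)) c.
Proof.
move=> hD hZ c; have h0 : h 0 = 0 by rewrite -(scale0r 0) hZ scale0r.
by rewrite /comb (big_morph h hD h0); apply: eq_bigr => i _; rewrite hZ.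
Qed.

Lemma linear_bij_matrix (A : comNzRingType) (V W : lmodType A) (r : nat)
    (E : 'I_r -> V) (E' : 'I_r -> W) (h : {linear V -> W}) :
  is_basis E -> is_basis E' -> bijective h ->
  exists P Q : 'M[A]_r, [/\ P *m Q = 1%:M, Q *m P = 1%:M &
    forall i, h (E i) = comb E' (row i P)].
Proof.
move=> hE hE' [k hk kh].
have hZ a x : h (a *: x) = a *: h x by rewrite linearZ.
have hD : {morph h : x y / x + y} by move=> x y; rewrite linearD.
have kD : {morph k : x y / x + y}.
  by move=> x y; rewrite -[x in LHS]kh -[y in LHS]kh -hD hk.
have kZ a x : k (a *: x) = a *: k x by rewrite -{1}[x]kh -hZ hk.
have [P hP] := comb_families (h \o E) hE'.
have [Q hQ] := comb_families (k \o E') hE.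
exists P, Q; split=> //; apply/row_matrixP => i.
- apply: (comb_inj hE); rewrite comb_row1 row_mul comb_mulmx -[RHS]hk.
  rewrite [X in k X]hP (linear_comb _ kD kZ); apply: eq_bigr => l _.
  by rewrite [k _]hQ.
- apply: (comb_inj hE'); rewrite comb_row1 row_mul comb_mulmx -[RHS]kh.
  rewrite [X in h X]hQ (linear_comb _ hD hZ); apply: eq_bigr => l _.
  by rewrite [h _]hP.
Qed.

Section Lattices.
Variables (R : realType) (F : fieldType) (v : absval R F).
Variables (S : comNzRingType) (j : {rmorphism S -> F}).
Hypotheses (j_inj : injective j) (j_le1 : forall s, v (j s) <= 1)
           (le1_j : forall y, v y <= 1 -> exists s, y = j s)
           (v0 : v 0 = 0).
Variables (V : lmodType F) (r : nat) (E : 'I_r -> V).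
Hypothesis hE : is_basis E.

Local Notation integral := (mxOver (integral_elt v)).

(** Vectors are rows of coordinates in E: the rows of B generate the lattice, and a change of
    lattice basis multiplies B on the left. *)
Definition lattice (B : 'M[F]_r) : set V :=
  [set w | exists2 c, c \is a integral & w = comb E (c *m B)].

Lemma integral_imageP m n (X : 'M[F]_(m, n)) :
  X \is a integral <-> exists Y : 'M[S]_(m, n), X = map_mx j Y.
Proof.
split=> [/integralP iX|[Y ->]]; last by apply/integralP => i k; rewrite mxE.
have /choice[f hf] i : exists f : 'I_n -> S, forall k, X i k = j (f k).
  have /choice[f hf] k := le1_j (iX i k).
  by exists f.
by exists (\matrix_(i, k) f i k); apply/matrixP => i k; rewrite !mxE.
Qed.

Lemma lattice_basis_rows (B : 'M[F]_r) : B \in unitmx ->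
  lattice_basis j (lattice B) (fun i => comb E (row i B)).
Proof.
have combE (c : 'rV[S]_r) : \sum_i j (c 0 i) *: comb E (row i B) =
    comb E (map_mx j c *m B).
  by rewrite comb_mulmx; apply: eq_bigr => i _; rewrite mxE.
move=> uB; split=> [c|w [_ /integral_imageP[c ->] ->]].
  by exists (map_mx j c) => //; apply/integral_imageP; exists c.
exists c; split=> [|d]; first by rewrite combE.
rewrite combE => /(comb_inj hE)/(can_inj (mulmxK uB))/matrixP cd.
by apply/matrixP => i k; apply: j_inj; have := cd i k; rewrite !mxE.
Qed.

Lemma lattice_basisP (B : 'M[F]_r) (e : 'I_r -> V) : B \in unitmx ->
  lattice_basis j (lattice B) e ->
  exists X Y, [/\ X \is a integral, Y \is a integral,
    forall i, e i = comb E (row i (X *m B)) & Y *m X = 1%:M].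
Proof.
move=> uB [L1 L2].
have /choice[X hX] i : exists c, c \is a integral /\ e i = comb E (c *m B).
  have := L1 (delta_mx 0 i); rewrite (bigD1 i)//= big1 ?addr0 => [|k ki].
    by rewrite mxE !eqxx rmorph1 scale1r => -[c ic ->]; exists c.
  by rewrite mxE (negbTE ki) rmorph0 scale0r.
have /choice[Y hY] i : exists c : 'rV[S]_r,
    comb E (row i B) = \sum_k j (c 0 k) *: e k.
  have [|c [hc _]] := L2 (comb E (row i B)); last by exists c.
  exists (delta_mx 0 i); last by rewrite rowE.
  apply/integralP => k l; rewrite mxE.
  by case: (_ && _); rewrite ?mulr1n ?mulr0n ?v0 ?absval1.
exists (\matrix_i X i), (\matrix_i map_mx j (Y i)); split.
- apply/integralP => i k; have [/integralP h _] := hX i.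
  by rewrite mxE.
- apply/integralP => i k; rewrite !mxE; exact: j_le1.
- by move=> i; rewrite row_mul rowK; case: (hX i).
- apply: (can_inj (mulmxK uB)); rewrite mul1mx -mulmxA.
  apply/row_matrixP => i; apply: (comb_inj hE).
  rewrite row_mul rowK comb_mulmx hY; apply: eq_bigr => k _.
  by rewrite mxE row_mul rowK; case: (hX k) => _ ->.
Qed.

Lemma lattice_integral_unit (U B : 'M[F]_r) : integral_unit v U ->
  lattice (U *m B) = lattice B.
Proof.
move=> [U' [iU iU' UU' U'U]]; apply/seteqP; split=> w [c ic ->].
  by exists (c *m U); rewrite ?mulmxA// mxOverM.
by exists (c *m U'); rewrite ?mxOverM// mulmxA -(mulmxA c) U'U mulmx1.
Qed.

Lemma row_diag_mulmx (x : 'I_r -> F) (B : 'M[F]_r) i :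
  row i (diag_mx (\row_i x i) *m B) = x i *: row i B.
Proof. by apply/rowP => k; rewrite mul_diag_mx !mxE. Qed.

(** The two factorizations with integral outer factors allow bounds on minors to pass from the
    diagonal matrix to P and back; they come from comparing an adapted basis with the standard bases
    of both lattices. *)
Lemma relative_positionP (q : nat) (P : 'M[F]_r) (L1 L2 : set V) :
  P \in unitmx -> L1 = lattice 1%:M -> L2 = lattice P ->
  exists x : 'I_r -> F, [/\ forall i, x i != 0,
    forall i k : 'I_r, (i <= k)%N -> v (x k) <= v (x i),
    forall i, relative_position q v j r L1 L2 0 i = ln (v (x i)) / ln q%:R,
    exists X Y, [/\ X \is a integral, Y \is a integral &
                    P = X *m diag_mx (\row_i x i) *m Y] &
    exists X Y, [/\ X \is a integral, Y \is a integral &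
                    diag_mx (\row_i x i) = X *m P *m Y]].
Proof.
move=> uP -> ->; rewrite /relative_position; case: xgetP => [d _|none].
  move=> [e [x [b1 x0 xdec b2 hd]]].
  have [X [Y [iX iY eX YX]]] := lattice_basisP (unitmx1 _ _) b1.
  have [X2 [Y2 [iX2 iY2 eX2 YX2]]] := lattice_basisP uP b2.
  have DX : diag_mx (\row_i x i) *m X = X2 *m P.
    apply/row_matrixP => i; apply: (comb_inj hE).
    by rewrite -eX2 row_diag_mulmx combZ eX mulmx1.
  exists x; split=> //.
    by exists Y2, X; split=> //; rewrite -mulmxA DX mulmxA YX2 mul1mx.
  by exists X2, Y; split=> //; rewrite -DX -mulmxA (mulmx1C YX) mulmx1.
(* The default value of [xget] is excluded by a Smith form P = U D W: the rows of W are a basis of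
   the first lattice, and the rows of D W a basis of the second. *)
exfalso.
have [C hC] : exists C, forall i k, v (P i k) <= C.
  exists (\sum_i \sum_k v (P i k)) => i k.
  rewrite (bigD1 i)//= (bigD1 k)//= -addrA lerDl addr_ge0//.
    by rewrite sumr_ge0// => l _; apply: absval_ge0.
  by rewrite sumr_ge0// => l _; rewrite sumr_ge0// => ? _; apply: absval_ge0.
have [U [W [x [iU iW xdec eP _]]]] := smith_form v0 hC.
have uD : diag_mx (\row_i x i) \in unitmx /\ W \in unitmx.
  by move: uP; rewrite eP !unitmx_mul => /andP[/andP[_ ->] ->].
apply: (none (\row_i (ln (v (x i)) / ln q%:R))).
exists (fun i => comb E (row i W)), x.
split=> //.
- rewrite -(lattice_integral_unit _ iW) mulmx1.
  by apply: lattice_basis_rows; case: uD.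
- move=> i; case: uD; rewrite unitmxE det_diag unitfE => /prodf_neq0/(_ i isT).
  by rewrite mxE.
- rewrite eP -mulmxA lattice_integral_unit//.
  under [X in lattice_basis _ _ X]funext => i do rewrite -combZ -row_diag_mulmx.
  by apply: lattice_basis_rows; rewrite unitmx_mul; apply/andP.
- by move=> i; rewrite mxE.
Qed.

End Lattices.

(** * The matrix of Frobenius and Hodge types *)

Section LocLift.
Variables (A : idomainType) (T : set A) (F : fieldType).
Variable g : {rmorphism A -> F}.

Lemma mulgen_neq0 : (forall t, T t -> g t != 0) ->
  forall s, mulgen T s -> g s != 0.
Proof.
move=> gT s [l lT ->]; rewrite rmorph_prod big_seq.
elim/big_rec: _ => [|x y xl].
  exact: oner_neq0.
by rewrite mulf_eq0 negb_or => ->; rewrite andbT; apply/gT/lT.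
Qed.

Lemma mulgen_tofrac_neq0 : (forall t, T t -> g t != 0) ->
  forall s, mulgen T s -> tofrac s != 0.
Proof.
move=> gT s /(mulgen_neq0 gT); rewrite tofrac_eq0.
by apply: contraNneq => ->; rewrite rmorph0.
Qed.

(** [loc_lift] evaluates g on one chosen fraction; as g does not vanish on denominators, every other
    fraction gives the same value. *)
Lemma loc_liftE (gT : forall t, T t -> g t != 0) (z : loc T) a s :
  is_loc T (\val z) a s -> loc_lift g z = g a / g s.
Proof.
rewrite /loc_lift /loc_frac; case: cid => -[b t] [/= ht ->] [hs].
have gs := mulgen_neq0 gT hs; have gt := mulgen_neq0 gT ht.
have s0 := mulgen_tofrac_neq0 gT hs; have t0 := mulgen_tofrac_neq0 gT ht.
move=> /eqP; rewrite eqr_div// -!rmorphM tofrac_eq => /eqP e.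
by apply/eqP; rewrite eqr_div// -!rmorphM e.
Qed.

(* The argument of [loc_map] is what makes [loc_lift g] a ring morphism; it is
   kept in the term so that the instances below can be inferred. *)
Definition loc_map (_ : forall t, T t -> g t != 0) : loc T -> F := loc_lift g.

Variable gT : forall t, T t -> g t != 0.

Lemma loc_map_zmod : zmod_morphism (loc_map gT).
Proof.
move=> x y; have [[a s] [/= hs ea]] := loc_elt_frac x.
have [[b t] [/= ht eb]] := loc_elt_frac y.
have gs := mulgen_neq0 gT hs; have gt := mulgen_neq0 gT ht.
have s0 := mulgen_tofrac_neq0 gT hs; have t0 := mulgen_tofrac_neq0 gT ht.
rewrite /loc_map (@loc_liftE gT x a s)// (@loc_liftE gT y b t)//.
rewrite (@loc_liftE gT _ (a * t - b * s) (s * t)).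
  by rewrite rmorphB !rmorphM -!mulNr addf_div.
split; first exact: mulgenM.
by rewrite rmorphB /= ea eb rmorphB !rmorphM /= -!mulNr addf_div.
Qed.

Lemma loc_map_monoid : monoid_morphism (loc_map gT).
Proof.
split.
  rewrite /loc_map (@loc_liftE gT _ 1 1) ?rmorph1 ?divr1//.
  by split; [exact: mulgen1|rewrite rmorph1 divr1].
move=> x y; have [[a s] [/= hs ea]] := loc_elt_frac x.
have [[b t] [/= ht eb]] := loc_elt_frac y.
rewrite /loc_map (@loc_liftE gT x a s)// (@loc_liftE gT y b t)//.
rewrite (@loc_liftE gT _ (a * b) (s * t)) ?rmorphM ?mulf_div//.
split; first exact: mulgenM.
by rewrite rmorphM /= ea eb !rmorphM /= mulf_div.
Qed.

HB.instance Definition _ :=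
  GRing.isZmodMorphism.Build (loc T) F (loc_map gT) loc_map_zmod.
HB.instance Definition _ :=
  GRing.isMonoidMorphism.Build (loc T) F (loc_map gT) loc_map_monoid.

Lemma loc_map_in a : loc_map gT (loc_in T a) = g a.
Proof.
rewrite /loc_map (@loc_liftE gT _ a 1) ?rmorph1 ?divr1//.
by split; [exact: mulgen1|rewrite rmorph1 divr1].
Qed.

End LocLift.

Lemma loc_in_inj (A : idomainType) (T : set A) : injective (loc_in T).
Proof.
by move=> a b /(congr1 (@loc_val _ _)) /eqP; rewrite /= tofrac_eq => /eqP.
Qed.

Lemma mulgen_set1 (A : idomainType) (x s : A) :
  mulgen [set x] s -> exists n, s = x ^+ n.
Proof.
move=> [l lx ->]; exists (size l); elim: l lx => [|y l ih] lx.
  by rewrite big_nil.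
rewrite big_cons exprS ih => [|z zl]; first by rewrite (lx y)// mem_head.
by apply: lx; rewrite in_cons zl orbT.
Qed.

Section HodgeType.
Variables (R : realType) (D : bkf_setting R) (r : nat) (M : bkf_module D r).
Variables (m : 'I_r -> M) (P Q : 'M[A_inv_xi' D]_r).
Hypotheses (m_basis : is_basis m) (PQ : P *m Q = 1%:M).
Hypothesis phiP : forall i,
  bkf_phi M (tens (to_inv_xi' D) 1 (tens (bk_phi D) 1 (m i))) =
  comb (fun k => tens (to_inv_xi' D) 1 (m k)) (row i P).

Variables (S : comNzRingType) (F : fieldType).
Variables (i : {rmorphism bkA D -> S}) (j : {rmorphism S -> F}).
Variable (v : absval R F).
Local Notation g := (j \o i).
Hypothesis g_xi' : forall t, [set bk_xi' D] t -> g t != 0.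
Hypotheses (j_inj : injective j) (j_le1 : forall s, v (j s) <= 1)
           (le1_j : forall y, v y <= 1 -> exists s, y = j s)
           (v0 : v 0 = 0).

Local Notation G := (loc_map g_xi').
Local Notation integral := (mxOver (integral_elt v)).

Lemma to_generic_tens (N : lmodType (bkA D)) s (n : N) :
  to_generic j (tens i s n) = tens g (j s) n.
Proof.
rewrite /to_generic tens_lift_tens//.
- by move=> n' s' t; rewrite rmorphD tensDl.
- by move=> s' n' n''; rewrite tensDr.
- by move=> s' a n'; rewrite rmorphM tens_bal.
Qed.

Lemma to_genericD (N : lmodType (bkA D)) :
  {morph @to_generic R D S F i j N : x y / x + y}.
Proof.
apply: tens_liftD.
- by move=> n' s' t; rewrite rmorphD tensDl.
- by move=> s' n' n''; rewrite tensDr.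
- by move=> s' a n'; rewrite rmorphM tens_bal.
Qed.

Lemma from_inv_hyps (N : lmodType (bkA D)) :
  let b := fun s (n : N) => tens g (loc_lift g s) n in
  [/\ forall n, {morph b^~ n : s t / s + t},
      forall s, {morph b s : n n' / n + n'} &
      forall s a n, b (s * to_inv_xi' D a) n = b s (a *: n)].
Proof.
split=> [n s t|s n n'|s a n] /=.
- by rewrite -[loc_lift _ _]/(G _) rmorphD tensDl.
- by rewrite tensDr.
- rewrite -[loc_lift _ _]/(G _) rmorphM -tens_bal; congr (tens _ (_ * _) _).
  exact: loc_map_in.
Qed.

Lemma range_to_generic (N : lmodType (bkA D)) (n : 'I_r -> N) : is_basis n ->
  range (@to_generic R D S F i j N) =
  lattice v (fun k => tens g 1 (n k)) 1%:M.
Proof.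
move=> n_basis; apply/seteqP; split=> w.
  move=> [x _ <-]; have [c [-> _]] := base_change_basis i n_basis x.
  exists (map_mx j c); first by apply/(integral_imageP j_le1 le1_j); exists c.
  rewrite mulmx1 (big_morph _ (to_genericD (N := N)) (id1 := 0)); last first.
    by rewrite -(tens0l i 0) to_generic_tens rmorph0 tens0l.
  by apply: eq_bigr => k _; rewrite mxE tensZ to_generic_tens mulr1 tensE.
move=> [c /(integral_imageP j_le1 le1_j)[d ->] ->].
exists (\sum_k tens i (d 0 k) (n k)) => //.
rewrite mulmx1 (big_morph _ (to_genericD (N := N)) (id1 := 0)); last first.
  by rewrite -(tens0l i 0) to_generic_tens rmorph0 tens0l.
by apply: eq_bigr => k _; rewrite mxE to_generic_tens tensE.
Qed.

Lemma phi_generic_hyps :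
  let b := fun s n =>
    s *: from_inv_xi' i j (bkf_phi M (tens (to_inv_xi' D) 1 n)) in
  [/\ forall n, {morph b^~ n : s t / s + t},
      forall s, {morph b s : n n' / n + n'} &
      forall s a n, b (s * g a) n = b s (a *: n)].
Proof.
have [h1 h2 h3] := from_inv_hyps M.
split=> [n s t|s n n'|s a n] /=; first by rewrite scalerDl.
  by rewrite tensDr linearD /from_inv_xi' tens_liftD// scalerDr.
rewrite -scalerA; congr (_ *: _).
have -> : tens (to_inv_xi' D) 1 (a *: n) =
    to_inv_xi' D a *: tens (to_inv_xi' D) 1 n.
  by rewrite -tens_bal tensZ mul1r mulr1.
rewrite linearZ /=; elim/base_change_ind: (bkf_phi M _) => [x y hx hy||s' n'].
- have fD : {morph @from_inv_xi' R D S F i j M : x y / x + y}.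
    exact: tens_liftD.
  by rewrite scalerDr !fD scalerDr hx hy.
- by rewrite scaler0 /from_inv_xi' tens_lift0// scaler0.
- rewrite tensZ /from_inv_xi' !tens_lift_tens// tensZ; congr (tens _ _ _).
  rewrite -![loc_lift _ _]/(G _) rmorphM; congr (_ * _).
  by rewrite [RHS]loc_map_in.
Qed.

Lemma phi_generic_comb (c : 'rV[F]_r) :
  phi_generic (i := i) (j := j)
    (comb (fun k => tens g 1 (tens (bk_phi D) 1 (m k))) c) =
  comb (fun k => tens g 1 (m k)) (c *m map_mx G P).
Proof.
have [h1 h2 h3] := phi_generic_hyps; have [k1 k2 k3] := from_inv_hyps M.
rewrite /phi_generic tens_lift_sum// comb_mulmx; apply: eq_bigr => k _.
rewrite tensZ tens_lift_tens// mulr1 phiP; congr (_ *: _).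
rewrite /from_inv_xi' tens_lift_sum//; apply: eq_bigr => l _.
by rewrite tensZ tens_lift_tens// mulr1 [LHS]tensE !mxE.
Qed.

(** In coordinates, [phi_generic] carries the standard lattice of the Frobenius twist onto the
    lattice spanned by the rows of the image of P in F, so the Hodge type is the position of that
    lattice relative to the standard one. *)
Lemma hodge_typeP :
  exists x : 'I_r -> F, [/\ forall k, x k != 0,
    forall k l : 'I_r, (k <= l)%N -> v (x l) <= v (x k),
    forall k, hodge_type M i j v 0 k = ln (v (x k)) / ln (lf_q (bkE D))%:R,
    exists X Y, [/\ X \is a integral, Y \is a integral &
                    map_mx G P = X *m diag_mx (\row_k x k) *m Y] &
    exists X Y, [/\ X \is a integral, Y \is a integral &
                    diag_mx (\row_k x k) = X *m map_mx G P *m Y]].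
Proof.
have mphi := base_change_basis (bk_phi D) m_basis.
apply: (relative_positionP j_inj j_le1 le1_j v0 (base_change_basis g m_basis)).
- have : map_mx G P *m map_mx G Q = 1%:M by rewrite -map_mxM PQ map_mx1.
  by move=> /mulmx1_unit[].
- exact: range_to_generic.
- rewrite (range_to_generic mphi); apply/seteqP; split=> w.
    move=> [_ [c ic ->] <-]; exists c => //.
    by rewrite mulmx1 phi_generic_comb.
  move=> [c ic ->]; rewrite -phi_generic_comb.
  by exists (comb (fun k => tens g 1 (tens (bk_phi D) 1 (m k))) c) => //;
    exists c; rewrite ?mulmx1.
Qed.

End HodgeType.

(** * Comparison of relative positions *)

Lemma absval_det_le1 (R : realType) (F : fieldType) (v : absval R F) n
    (X : 'M[F]_n) :
  v 0 = 0 -> X \is a mxOver (integral_elt v) -> v (\det X) <= 1.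
Proof.
move=> v0 /integralP iX; apply: absval_sum_le => // t _.
rewrite absvalM absval_sign mul1r absval_prod.
by apply: prodr_ile1 => i _; rewrite absval_ge0 iX.
Qed.

Lemma sum_ln (R : realType) (I : Type) (s : seq I) (p : pred I) (y : I -> R) :
  (forall i, 0 < y i) ->
  \sum_(i <- s | p i) ln (y i) = ln (\prod_(i <- s | p i) y i).
Proof.
move=> y0; suff [] : 0 < \prod_(i <- s | p i) y i /\
  \sum_(i <- s | p i) ln (y i) = ln (\prod_(i <- s | p i) y i) by [].
elim/big_rec2: _ => [|i t u _ [t0 ->]]; first by rewrite ln1.
by rewrite lnM ?posrE// mulr_gt0.
Qed.

Section Comparison.
Variables (R : realType) (B : comNzRingType) (r : nat) (P Q : 'M[B]_r).
Hypothesis PQ : P *m Q = 1%:M.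

Definition has_position (F : fieldType) (v : absval R F)
    (G : {rmorphism B -> F}) (x : 'I_r -> F) : Prop :=
  [/\ forall k, x k != 0,
    forall k l : 'I_r, (k <= l)%N -> v (x l) <= v (x k),
    exists X Y,
      [/\ X \is a mxOver (integral_elt v), Y \is a mxOver (integral_elt v) &
          map_mx G P = X *m diag_mx (\row_k x k) *m Y] &
    exists X Y,
      [/\ X \is a mxOver (integral_elt v), Y \is a mxOver (integral_elt v) &
          diag_mx (\row_k x k) = X *m map_mx G P *m Y]].

Lemma prod_position (F : fieldType) (v : absval R F)
    (G : {rmorphism B -> F}) x :
  v 0 = 0 -> has_position v G x -> \prod_k v (x k) = v (G (\det P)).
Proof.
move=> v0 [x0 xdec [X [Y [iX iY eP]]] [X' [Y' [iX' iY' eD]]]].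
have detD : v (\det (diag_mx (\row_k x k))) = \prod_k v (x k).
  by rewrite det_diag absval_prod; apply: eq_bigr => k _; rewrite mxE.
apply/eqP; rewrite eq_le -det_map_mx; apply/andP; split.
  rewrite -detD eD !det_mulmx mulrAC !absvalM ler_piMl ?absval_ge0//.
  by rewrite mulr_ile1 ?absval_ge0// absval_det_le1.
rewrite eP !det_mulmx mulrAC !absvalM -detD ler_piMl ?absval_ge0//.
by rewrite mulr_ile1 ?absval_ge0// absval_det_le1.
Qed.

Variables (F1 F2 : fieldType) (v1 : absval R F1) (v2 : absval R F2).
Variables (G1 : {rmorphism B -> F1}) (G2 : {rmorphism B -> F2}).
Hypotheses (v10 : v1 0 = 0) (v20 : v2 0 = 0).
Hypothesis G12 : forall z, v1 (G1 z) <= v2 (G2 z).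

Lemma type_le_position (q : nat) (x1 : 'I_r -> F1) (x2 : 'I_r -> F2)
    (d1 d2 : 'rV[R]_r) : (1 < q)%N ->
  has_position v1 G1 x1 -> has_position v2 G2 x2 ->
  (forall k, d1 0 k = ln (v1 (x1 k)) / ln q%:R) ->
  (forall k, d2 0 k = ln (v2 (x2 k)) / ln q%:R) ->
  type_le d1 d2.
Proof.
move=> q1 p1 p2 hd1 hd2.
have lnq : 0 < ln (q%:R : R) by rewrite ln_gt0// ltr1n.
have [n1 xdec1 _ [X [Y [iX iY eD]]]] := p1.
have [n2 xdec2 [X' [Y' [iX2 iY2 eP]]] _] := p2.
have y1 k : 0 < v1 (x1 k) by rewrite absval_gt0.
have y2 k : 0 < v2 (x2 k) by rewrite absval_gt0.
split=> [s sr|].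
  under eq_bigr do rewrite hd1; under [leRHS]eq_bigr do rewrite hd2.
  rewrite -!mulr_suml ler_pM2r ?invr_gt0// !sum_ln//.
  rewrite ler_ln ?posrE ?prodr_gt0//.
  (* C is the product of the s largest divisors for [v2], so it bounds the minors of P there. Minors
     of P are elements of B, so [G12] carries the bound over to [v1], where the leading minor of the
     diagonal matrix is the product sought. *)
  set C := leRHS; have C0 : 0 <= C.
    by apply: prodr_ge0 => k _; apply: absval_ge0.
  have mP2 : minors_le v2 s C (map_mx G2 P).
    rewrite eP; apply: minors_leMr => //; apply: minors_leMl => //.
    exact: minors_le_diag.
  apply: minors_le_diagP => //; rewrite eD; apply: minors_leMr => //.
  apply: minors_leMl => // f h; rewrite -map_mxsub det_map_mx.
  by apply: le_trans (G12 _) _; rewrite -det_map_mx map_mxsub.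
under eq_bigr do rewrite hd1; under [RHS]eq_bigr do rewrite hd2.
rewrite -!mulr_suml !sum_ln// (prod_position v10 p1) (prod_position v20 p2).
congr (ln _ / _); apply: le_anti; rewrite G12 /=.
have detPQ : \det P * \det Q = 1 by rewrite -det_mulmx PQ det1.
have vPQ (F : fieldType) (v : absval R F) (G : {rmorphism B -> F}) :
    v (G (\det P)) * v (G (\det Q)) = 1.
  by rewrite -absvalM -rmorphM detPQ rmorph1 absval1.
have Q0 (F : fieldType) (v : absval R F) (G : {rmorphism B -> F}) :
    0 < v (G (\det Q)).
  rewrite lt_def absval_ge0 andbT; apply/eqP => h.
  by move: (vPQ F v G) => /eqP; rewrite h mulr0 eq_sym oner_eq0.
have PE (F : fieldType) (v : absval R F) (G : {rmorphism B -> F}) :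
    v (G (\det P)) = (v (G (\det Q)))^-1.
  by apply: (mulIf (lt0r_neq0 (Q0 F v G))); rewrite vPQ mulVf// lt0r_neq0.
by rewrite !PE lef_pV2 ?posrE.
Qed.

End Comparison.

(** * Prime elements, normalized valuations and completions *)

Definition adic_separated (A : comNzRingType) (x : A) : Prop :=
  forall a, (forall n, exists b, a = x ^+ n * b) -> a = 0.

(** Successive approximation: the digits given by [step] form a series in t that converges in W. A
    ring morphism turns congruences modulo t^n into congruences modulo h(t)^n, so separatedness of C
    identifies the image of the limit with c. It is applied to both theta and phi. *)
Lemma witt_lift_surj (O : comNzRingType) (pi : O) (B : comNzRingType)
    (str : {rmorphism O -> B}) (W : witt_vectors pi str) (C : comNzRingType)
    (h : {rmorphism W -> C}) :
  adic_separated (h (witt_str W pi)) ->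
  (forall c, exists a c', c = h a + h (witt_str W pi) * c') ->
  forall c, exists a, h a = c.
Proof.
set t := witt_str W pi => sep step c.
have /choice[f hf] : forall c, exists ac, c = h ac.1 + h t * ac.2.
  by move=> d; have [a [d' ->]] := step d; exists (a, d').
pose cs n := iter n (fun d => (f d).2) c.
pose u n := \sum_(i < n) t ^+ i * (f (cs i)).1.
have uE n : c = h (u n) + h t ^+ n * cs n.
  elim: n => [|n ih]; first by rewrite /u big_ord0 rmorph0 add0r mul1r.
  rewrite /u big_ord_recr /= rmorphD -addrA {1}ih; congr (_ + _).
  by rewrite {1}[cs n]hf rmorphM rmorphXn exprSr mulrDr mulrA.
have [n|l hl] := witt_complete (w := W) (u := u).
  by exists (f (cs n)).1; rewrite /u big_ord_recr /= [X in X - _]addrC addrK.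
exists l; apply/eqP; rewrite -subr_eq0; apply/eqP/sep => n.
have [b hb] := hl n; exists (- h b - cs n).
rewrite {1}(uE n) opprD addrA -rmorphB -[l - _]opprB hb rmorphN rmorphM
  rmorphXn.
by rewrite mulrBr mulrN.
Qed.

Section PrimeElements.
Variables (A : idomainType) (x : A).

Definition prime_elt : Prop := [/\ x != 0, ~ principal x 1 &
  forall a b, principal x (a * b) -> principal x a \/ principal x b].

Hypothesis px : prime_elt.

Lemma prime_notX s n : ~ principal x s -> ~ principal x (s ^+ n).
Proof.
case: px => _ x1 xM xs; elim: n => [|n ih]; first by rewrite expr0.
by rewrite exprS => /xM[].
Qed.

Lemma prime_cancel s a n u : ~ principal x s -> a * s = x ^+ n * u ->
  exists b, a = x ^+ n * b.
Proof.
case: px => x0 _ xM xs; elim: n a => [|n ih] a e.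
  by exists a; rewrite mul1r.
have [|[b eb]|//] := xM a s.
  by exists (x ^+ n * u); rewrite e exprS -mulrA mulrC.
have [|c ec] := ih b; last by exists c; rewrite eb ec exprSr mulrAC.
by apply: (mulfI x0); rewrite !mulrA -exprS -e eb [b * x]mulrC.
Qed.

Lemma mulgen_prime s : mulgen (~` principal x) s -> ~ principal x s.
Proof.
case: px => _ x1 xM [l hl ->]; elim: l hl => [|y l ih] hl.
  by rewrite big_nil.
rewrite big_cons => /xM[|]; first by apply: hl; rewrite mem_head.
by apply: ih => z zl; apply: hl; rewrite in_cons zl orbT.
Qed.

Lemma loc_prime_cancel a n (c : loc (~` principal x)) :
  loc_in _ a = loc_in _ x ^+ n * c -> exists b, a = x ^+ n * b.
Proof.
have [[u s] [/= ms ec]] := loc_elt_frac c.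
have xs := mulgen_prime ms.
have s0 : s != 0 by apply: contra_notN xs => /eqP->; exists 0; rewrite mul0r.
move=> /(congr1 val); rewrite rmorphM rmorphXn /= ec.
have s0' : tofrac s != 0 by rewrite tofrac_eq0.
move=> /(congr1 ( *%R^~ (tofrac s))); rewrite mulrA divfK// -!rmorphXn
  -!rmorphM.
by move=> /eqP; rewrite tofrac_eq => /eqP; apply: prime_cancel.
Qed.

Lemma loc_prime (t : A) : ~ principal x t -> t != 0 ->
  forall a, principal (loc_in [set t] x) (loc_in [set t] a) -> principal x a.
Proof.
move=> xt t0 a [c ec].
have [[u s] [/= /mulgen_set1[n ->] euc]] := loc_elt_frac c.
have tn0 : tofrac (t ^+ n) != 0 by rewrite tofrac_eq0 expf_neq0.
move: ec => /(congr1 (@loc_val _ _)); rewrite /= euc.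
move=> /(congr1 ( *%R^~ (tofrac (t ^+ n)))); rewrite mulrAC divfK// -!rmorphM.
move=> /eqP; rewrite tofrac_eq => /eqP e.
have [|b ->] := @prime_cancel (t ^+ n) a 1 u (prime_notX (n := n) xt).
  by rewrite e expr1 mulrC.
by exists b; rewrite expr1 mulrC.
Qed.

Lemma loc_set1_num (t : A) (z : loc [set t]) : t != 0 ->
  exists n a, z * loc_in _ (t ^+ n) = loc_in _ a.
Proof.
move=> t0; have [[a s] [/= /mulgen_set1[n ->] e]] := loc_elt_frac z.
exists n, a; apply: val_inj; rewrite rmorphM /= e divfK//.
by rewrite tofrac_eq0 expf_neq0.
Qed.

Lemma loc_set1_unit (t : A) n : t != 0 ->
  exists z : loc [set t], loc_in _ (t ^+ n) * z = 1.
Proof.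
move=> t0; have h : loc_elt [set t] (tofrac 1 / tofrac (t ^+ n)).
  apply/asboolP; exists 1, (t ^+ n); split=> //; exists (nseq n t).
    by move=> y /nseqP[->].
  by rewrite big_nseq iter_mulr_1.
exists (Loc h); apply: val_inj; rewrite rmorphM /= !rmorph1 mulrC divfK//.
by rewrite tofrac_eq0 expf_neq0.
Qed.

End PrimeElements.

(** B'_dR is built from A[1/pi], so the primality of xi' has to be carried there. Elements of A[1/t]
    are tested for divisibility after clearing a power of the unit t. *)
Lemma prime_elt_loc (A : idomainType) (x t : A) : prime_elt x ->
  ~ principal x t -> t != 0 -> prime_elt (loc_in [set t] x).
Proof.
move=> px xt t0; case: (px) => x0 x1 xM; split.
- apply: contra_neq x0 => h; apply: (@loc_in_inj _ [set t]).
  by rewrite h rmorph0.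
- by rewrite -(rmorph1 (@loc_in _ [set t])) => /(loc_prime px xt t0).
- have num z a n : z * loc_in [set t] (t ^+ n) = loc_in _ a -> principal x a ->
      principal (loc_in [set t] x) z.
    move=> e [b eb]; have [w ew] := loc_set1_unit n t0.
    exists (loc_in _ b * w).
    by rewrite mulrAC -rmorphM -eb /= -e -mulrA ew mulr1.
  move=> y z [c eyz].
  have [i [a ea]] := loc_set1_num y t0; have [k [b eb]] := loc_set1_num z t0.
  have /(loc_prime px xt t0)/xM[] :
      principal (loc_in [set t] x) (loc_in [set t] (a * b)).
  + exists (c * (loc_in _ (t ^+ i) * loc_in _ (t ^+ k))).
    by rewrite rmorphM /= -ea -eb mulrACA eyz mulrAC.
  + by left; apply: num ea _.
  + by right; apply: num eb _.
Qed.

Section NormalizedValuation.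
Variables (R : realType) (q : nat) (O : idomainType) (x : O).
Variable v : absval R {fraction O}.
Hypotheses (q1 : (1 < q)%N) (hv : normalized_absval q x v).

Let q0 : 0 < q%:R :> R. Proof. by rewrite ltr0n (ltn_trans _ q1). Qed.
Let qV1 : (q%:R : R)^-1 < 1. Proof. by rewrite invf_lt1// ltr1n. Qed.

Lemma normalized_absval0 : v 0 = 0.
Proof. by apply: (@absval0 _ _ _ (tofrac x)); rewrite hv.1 lt_eqF. Qed.

Lemma normalized_absval_le1 a : v (tofrac a) <= 1.
Proof. by apply/hv.2; exists a. Qed.

Lemma normalized_absval_lt1 b : v (tofrac (x * b)) < 1.
Proof.
rewrite rmorphM absvalM hv.1; apply: le_lt_trans qV1.
by rewrite ler_piMr ?normalized_absval_le1// invr_ge0 ltW.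
Qed.

Lemma normalized_absval_dvd a n : v (tofrac a) <= q%:R ^- n ->
  exists b, a = x ^+ n * b.
Proof.
have x0 : tofrac x != 0.
  by apply/eqP => h; move: hv.1; rewrite h normalized_absval0 => /esym/eqP;
    rewrite invr_eq0 gt_eqF.
move=> h; have [|b hb] := (hv.2 (tofrac a / tofrac x ^+ n)).1.
  rewrite absvalM absvalV ?normalized_absval0// absvalX hv.1 exprVn invrK.
  by rewrite -ler_pdivlMr ?exprn_gt0// mul1r.
exists b; apply/eqP; rewrite -tofrac_eq; apply/eqP.
by rewrite rmorphM rmorphXn /= -hb mulrC divfK// expf_neq0.
Qed.

Hypothesis sep : adic_separated x.
Hypothesis v_unit : forall a, (forall b, a <> x * b) -> v (tofrac a) = 1.

Lemma normalized_absval_nat a : a != 0 -> exists n, v (tofrac a) = q%:R ^- n.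
Proof.
move=> a0; have : exists n, ~~ `[< exists b, a = x ^+ n * b >].
  apply/not_existsP => h; move/eqP: a0; apply; apply: sep => n.
  by apply: contrapT => ha; apply: (h n); apply/negP => /asboolP.
(* The least exponent that fails is n + 1, so x^n divides a exactly and [v_unit] applies to the
   cofactor. *)
move=> /ex_minnP[[|n] /asboolPn hn nmin].
  by case: hn; exists a; rewrite mul1r.
have /asboolP[b eb] : `[< exists b, a = x ^+ n * b >].
  by apply/negPn/negP => /nmin; rewrite ltnn.
exists n; rewrite eb rmorphM rmorphXn absvalM absvalX hv.1 exprVn v_unit
  ?mulr1//.
by move=> c ec; apply: hn; exists c; rewrite eb ec mulrA -exprSr.
Qed.

Lemma normalized_absval_int y : y != 0 -> exists k : int, v y = q%:R ^ k.
Proof.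
move=> y0; have [vy|vy] := leP (v y) 1.
  have [a ea] := (hv.2 y).1 vy; have [|n en] := @normalized_absval_nat a.
    by rewrite -tofrac_eq0 -ea.
  by exists (- n%:Z); rewrite ea en -exprnN.
have vy' : v y^-1 <= 1.
  by rewrite absvalV ?normalized_absval0// invf_le1 ?ltW// (lt_trans ltr01).
have [a ea] := (hv.2 y^-1).1 vy'; have [|n en] := @normalized_absval_nat a.
  by rewrite -tofrac_eq0 -ea invr_eq0.
exists n%:Z; rewrite -[y]invrK ea absvalV ?normalized_absval0//.
by rewrite en invrK.
Qed.

End NormalizedValuation.

Section Completion.
Variables (R : realType) (q : nat) (A : idomainType) (x : A) (C : idomainType).
Variable j : {rmorphism loc (~` principal x) -> C}.
Variable v : absval R {fraction C}.
Hypotheses (q1 : (1 < q)%N) (px : prime_elt x).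
Hypothesis jC : is_completion (loc_in _ x) j.
Hypothesis hv : normalized_absval q (j (loc_in _ x)) v.

Lemma completion_dvd a n c : j (loc_in _ a) = j (loc_in _ x) ^+ n * c ->
  exists b, a = x ^+ n * b.
Proof.
move=> e; case: jC => + _ _ _ => /(_ n (loc_in _ a))[]; first by exists c.
by move=> b; apply: loc_prime_cancel.
Qed.

(** Modulo x, c is a fraction u / s of the local ring. If x divided u it would divide c; so u / s is
    a unit, of absolute value 1, and c differs from it by an element of absolute value less than
    1. *)
Lemma completion_unit c : (forall b, c <> j (loc_in _ x) * b) ->
  v (tofrac c) = 1.
Proof.
move=> cx; case: jC => _ + _ _ => /(_ 1%N c)[a [d]]; rewrite expr1 => ec.
have [[u s] [/= ms ea]] := loc_elt_frac a.
have s0 : tofrac s != 0.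
  rewrite tofrac_eq0; apply: contra_notN (mulgen_prime px ms) => /eqP->.
  by exists 0; rewrite mul0r.
have xu : ~ principal x u.
  move=> [w ew]; have h : loc_elt (~` principal x) (tofrac w / tofrac s).
    by apply/asboolP; exists w, s.
  apply: (cx (j (Loc h) + d)); rewrite ec mulrDr -rmorphM; congr (j _ + _).
  by apply: val_inj; rewrite rmorphM /= ea ew rmorphM mulrAC mulrC.
have u0 : tofrac u != 0.
  rewrite tofrac_eq0; apply: contra_notN xu => /eqP->.
  by exists 0; rewrite mul0r.
have h : loc_elt (~` principal x) (tofrac s / tofrac u).
  apply/asboolP; exists s, u; split=> //.
  exists [:: u]; last by rewrite big_seq1.
  by move=> y; rewrite inE => /eqP->.
have ju : j a * j (Loc h) = 1.
  rewrite -rmorphM -(rmorph1 j); congr (j _); apply: val_inj.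
  by rewrite rmorphM /= ea mulf_div [tofrac s * _]mulrC divff ?rmorph1//
    mulf_neq0.
have va : v (tofrac (j a)) = 1.
  apply/le_anti/andP; split; first exact: (normalized_absval_le1 hv).
  have := normalized_absval_le1 hv (j (Loc h)).
  have : v (tofrac (j a)) * v (tofrac (j (Loc h))) = 1.
    by rewrite -absvalM -rmorphM ju rmorph1 absval1.
  by move=> hM hle; rewrite -hM ler_piMr ?absval_ge0.
have vd := normalized_absval_lt1 q1 hv d.
apply/le_anti/andP; split; first exact: (normalized_absval_le1 hv).
rewrite leNgt; apply/negP => vc.
have : v (tofrac (j a)) < 1.
  rewrite (_ : j a = c - j (loc_in _ x) * d); last by rewrite ec addrK.
  rewrite rmorphB; apply: le_lt_trans (absvalD _ _ _) _.
  by rewrite gt_max absvalN vc.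
by rewrite va ltxx.
Qed.

End Completion.

(** * Perfectoid fields and tilts *)

Lemma exists_expr_lt (R : realType) (x e : R) : 0 <= x < 1 -> 0 < e ->
  exists n, x ^+ n < e.
Proof.
move=> /andP[x0 x1] e0; move: x0; rewrite le_eqVlt => /predU1P[<-|x0].
  by exists 1%N; rewrite expr1.
have h0 : 0 < x^-1 - 1 by rewrite subr_gt0 invf_gt1.
have bernoulli n : 1 + n%:R * (x^-1 - 1) <= x^-1 ^+ n.
  elim: n => [|n ih]; first by rewrite mul0r addr0.
  have -> : x^-1 ^+ n.+1 = (x^-1 - 1) * x^-1 ^+ n + x^-1 ^+ n.
    by rewrite exprS mulrBl mul1r subrK.
  apply: le_trans (lerD (ler_wpM2l (ltW h0) ih) ih).
  rewrite -natr1 mulrDl mul1r addrA [_ * (1 + _)]mulrDr mulr1 addrC lerD//.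
  by rewrite lerDl !mulr_ge0// ltW.
have [n hn] : exists n : nat, e^-1 / (x^-1 - 1) < n%:R.
  exists (Num.bound (e^-1 / (x^-1 - 1))); apply: le_lt_trans (archi_boundP _).
    exact: lexx.
  by rewrite divr_ge0 ?invr_ge0// ltW.
exists n; rewrite -[x]invrK exprVn -[e]invrK ltf_pV2 ?posrE ?invr_gt0 ?exprn_gt0
  ?invr_gt0//.
apply: lt_le_trans (bernoulli n); rewrite ltr_wpDl//.
by rewrite -ltr_pdivrMr.
Qed.

Section Perfectoid.
Variables (R : realType) (K : fieldType) (v : absval R K) (p : nat).
Hypotheses (p_prime : prime p) (hK : is_perfectoid v p).
Variable Kb : tilt v p.

Lemma perfectoid_absval0 : v 0 = 0.
Proof.
by case: hK => vp _ _ _; apply: (@absval0 _ _ _ p%:R); rewrite lt_eqF.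
Qed.

Let v0 := perfectoid_absval0.
Let vp1 : v p%:R < 1. Proof. by case: hK. Qed.
Let vp0 : 0 <= v p%:R. Proof. exact: absval_ge0. Qed.

Lemma absvalB a b : v (a - b) <= Num.max (v a) (v b).
Proof. by rewrite -[v b](absvalN v); apply: absvalD. Qed.

Lemma absval_distC a b : v (a - b) = v (b - a).
Proof. by rewrite -absvalN opprB. Qed.

Lemma absval_trans a b c e : v (a - b) <= e -> v (b - c) <= e -> v (a - c) <= e.
Proof.
move=> ab bc; rewrite -(subrK b a) -addrA; apply: le_trans (absvalD _ _ _) _.
by rewrite ge_max ab bc.
Qed.

Lemma absval_trans_lt a b c e : v (a - b) < e -> v (b - c) < e -> v (a - c) < e.
Proof.
move=> ab bc; rewrite -(subrK b a) -addrA; apply: le_lt_trans (absvalD _ _ _) _.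
by rewrite gt_max ab bc.
Qed.

Lemma absval_close_le a b e : v b <= e -> v (a - b) <= e -> v a <= e.
Proof.
move=> be; rewrite -{2}[a](subrK b) => abe.
by apply: le_trans (absvalD _ _ _) _; rewrite ge_max abe be.
Qed.

Lemma absval_close a b : v (a - b) < v b -> v a = v b.
Proof.
move=> h; apply/le_anti/andP; split; first exact: absval_close_le (ltW h).
rewrite leNgt; apply/negP => ab; have : v b < v b.
  rewrite -{1}(subKr a b); apply: le_lt_trans (absvalB _ _) _.
  by rewrite gt_max ab h.
by rewrite ltxx.
Qed.

Lemma absvalX_dist a b m : v a <= 1 -> v b <= 1 ->
  v (a ^+ m - b ^+ m) <= v (a - b).
Proof.
move=> a1 b1; rewrite subrXX absvalM ler_piMr ?absval_ge0//.
apply: absval_sum_le => // i _.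
by rewrite absvalM !absvalX mulr_ile1 ?exprn_ge0 ?absval_ge0// exprn_ile1
  ?absval_ge0.
Qed.

Lemma absvalXp_dist a b e : v a <= 1 -> v b <= 1 -> v (a - b) <= e ->
  e <= v p%:R -> v (a ^+ p - b ^+ p) <= v p%:R * e.
Proof.
move=> a1 b1 abe ep; rewrite subrXX absvalM mulrC ler_pM ?absval_ge0//.
(* Modulo a - b, the cofactor of a - b in a^p - b^p is p b^(p-1). *)
rewrite (eq_bigr (fun i : 'I_p => (a ^+ (p.-1 - i) - b ^+ (p.-1 - i)) * b ^+ i +
    b ^+ p.-1)); last first.
  move=> i _; rewrite mulrBl -exprD subnK ?subrK//.
  by rewrite -ltnS prednK ?prime_gt0.
rewrite big_split /= sumr_const card_ord -[_ ^+ _ *+ p]mulr_natr.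
apply: le_trans (absvalD _ _ _) _; rewrite ge_max; apply/andP; split.
  apply: absval_sum_le => // i _; apply: le_trans ep; apply: le_trans abe.
  apply: le_trans (absvalX_dist (p.-1 - i) a1 b1).
  rewrite absvalM ler_piMr ?absval_ge0//.
  by rewrite absvalX exprn_ile1 ?absval_ge0.
by rewrite absvalM absvalX ler_piMl// exprn_ile1 ?absval_ge0.
Qed.

Lemma absvalXpn_dist a b m : v a <= 1 -> v b <= 1 -> v (a - b) <= v p%:R ->
  v (a ^+ (p ^ m) - b ^+ (p ^ m)) <= v p%:R ^+ m.+1.
Proof.
move=> a1 b1 ab; elim: m => [|m ih]; first by rewrite expn0 !expr1.
rewrite expnSr !exprM exprS; apply: absvalXp_dist ih _.
- by rewrite absvalX exprn_ile1 ?absval_ge0.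
- by rewrite absvalX exprn_ile1 ?absval_ge0.
- by rewrite exprS ler_piMr// exprn_ile1// ltW.
Qed.

(** Frobenius is surjective modulo p, so x has a sequence of successive p-th roots modulo p. Raising
    to p-th powers contracts distances, which turns this sequence into an exact one, that is, a
    point of the tilt. *)
Lemma sharp_approx x : v x <= 1 -> exists y : Kb, v (sharp y - x) <= v p%:R.
Proof.
move=> x1; case: (hK) => _ complete _ frob.
have /choice[root hroot] a : exists y,
    v a <= 1 -> v y <= 1 /\ v (y ^+ p - a) <= v p%:R.
  have [a1|a1] := leP (v a) 1; last by exists 0.
  have [y [z [y1 z1 ->]]] := frob a a1; exists y => _; split=> //.
  by rewrite opprD addrA subrr sub0r absvalN absvalM ler_piMr.
pose s n := iter n root x.
have s1 n : v (s n) <= 1 by elim: n => // n /hroot[].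
have sp n : v (s n.+1 ^+ p - s n) <= v p%:R by have [] := hroot _ (s1 n).
(* The n-th coordinate of y is the limit of t n m as m tends to infinity. *)
pose t n m := s (n + m)%N ^+ (p ^ m).
have t1 n m : v (t n m) <= 1 by rewrite absvalX exprn_ile1 ?absval_ge0.
have tS n m : v (t n m.+1 - t n m) <= v p%:R ^+ m.+1.
  rewrite /t expnS exprM addnS; apply: absvalXpn_dist => //.
  by rewrite absvalX exprn_ile1 ?absval_ge0.
have tD n m k : v (t n (m + k)%N - t n m) <= v p%:R ^+ m.+1.
  elim: k => [|k ih]; first by rewrite addn0 subrr v0 exprn_ge0.
  rewrite addnS; apply: absval_trans ih; apply: le_trans (tS _ _) _.
  by rewrite ler_wiXn2l// ?ltW// ltnS leq_addr.
have /choice[l hl] n : exists l, absval_cvg v (t n) l.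
  apply: complete => e e0; have [|N hN] := @exists_expr_lt R (v p%:R) e _ e0.
    by rewrite vp0 vp1.
  exists N => m k Nm Nk; have h a : (N <= a)%N -> v (t n a - t n N) < e.
    move=> /subnKC <-; apply: le_lt_trans (tD _ _ _) (le_lt_trans _ hN).
    by rewrite exprS ler_piMl ?exprn_ge0// ltW.
  by apply: absval_trans_lt (h _ Nm) _; rewrite absval_distC h.
have l1 n : v (l n) <= 1.
  have [N hN] := hl n 1 ltr01; apply: absval_close_le (t1 n N) _.
  by rewrite absval_distC ltW// hN.
have lp n : l n.+1 ^+ p = l n.
  apply/eqP; rewrite -subr_eq0; apply/negPn/negP => /(absval_gt0 v) e0.
  have [N hN] := hl n _ e0; have [N' hN'] := hl n.+1 _ e0.
  have : v (l n.+1 ^+ p - l n) < v (l n.+1 ^+ p - l n).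
    apply: (@absval_trans_lt _ (t n (N + N').+1)).
      apply: le_lt_trans (hN' (N + N')%N (leq_addl _ _)).
      rewrite /t addnS -addSn expnSr exprM -/(t n.+1 (N + N')%N)
        [leRHS]absval_distC.
      exact: absvalX_dist.
    by apply: hN; rewrite leqW// leq_addr.
  by rewrite ltxx.
have [y [hy _]] := tilt_coord_bij Kb lp; exists y; rewrite /sharp hy.
rewrite leNgt; apply/negP => h; have e0 := le_lt_trans vp0 h.
have [N hN] := hl 0%N _ e0; have : v (l 0%N - x) < v (l 0%N - x).
  apply: (@absval_trans_lt _ (t 0%N N)); first by rewrite absval_distC hN.
  apply: le_lt_trans h; have := tD 0%N 0%N N.
  by rewrite add0n {2}/t expn0 !expr1.
by rewrite ltxx.
Qed.

Lemma sharpM (x y : Kb) : sharp (x * y) = sharp x * sharp y.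
Proof. exact: tilt_coordM. Qed.

(** Multiplicativity leaves only 0 and 1; the value 0 is excluded because a positive power of it is
    the absolute value of 1 in the tilt. *)
Lemma absval_sharp1 : v (sharp (1 : Kb)) = 1.
Proof.
have h : v (sharp (1 : Kb)) * v (sharp (1 : Kb)) = v (sharp (1 : Kb)).
  by rewrite -absvalM -sharpM mulr1.
have /eqP := h; rewrite -subr_eq0 -{3}[v _]mulr1 -mulrBr mulf_eq0 subr_eq0.
move=> /orP[/eqP s0|/eqP//]; have [c c0 /(_ 1)] := tilt_vE Kb.
by rewrite absval1 -/(sharp _) s0 powR0 ?gt_eqF// => /eqP; rewrite oner_eq0.
Qed.

Lemma absval_sharpX (x : Kb) n : v (sharp (x ^+ n)) = v (sharp x) ^+ n.
Proof.
elim: n => [|n ih]; first by rewrite absval_sharp1.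
by rewrite !exprS sharpM absvalM ih.
Qed.

Lemma tilt_le1 (x : Kb) : (tilt_v Kb x <= 1) = (v (sharp x) <= 1).
Proof.
have [c c0 ->] := tilt_vE Kb; have p1 : 1 `^ c = 1 :> R by rewrite powR1.
apply/idP/idP => h.
  rewrite leNgt; apply/negP => h1; move: h; rewrite leNgt => /negP; apply.
  rewrite -[ltLHS]p1; apply: gt0_ltr_powR => //; rewrite ?nnegrE ?absval_ge0//.
rewrite -[leRHS]p1; apply: ge0_ler_powR; rewrite ?nnegrE ?absval_ge0// ltW//.
Qed.

Lemma tilt_lt1 (x : Kb) : (tilt_v Kb x < 1) = (v (sharp x) < 1).
Proof.
have [c c0 ->] := tilt_vE Kb; have p1 : 1 `^ c = 1 :> R by rewrite powR1.
apply/idP/idP => h.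
  rewrite ltNge; apply/negP => h1; move: h; rewrite ltNge => /negP; apply.
  rewrite -[leLHS]p1; apply: ge0_ler_powR => //;
    rewrite ?nnegrE ?absval_ge0// ltW//.
rewrite -[ltRHS]p1; apply: gt0_ltr_powR; rewrite ?nnegrE ?absval_ge0//.
Qed.

Lemma sharp_absval_gt x : v x <= 1 -> v p%:R < v x ->
  exists y : Kb, v (sharp y) = v x.
Proof.
move=> /sharp_approx[y hy] px; exists y.
by apply: absval_close; apply: le_lt_trans px.
Qed.

(** Approximation modulo p only reaches values above |p|. With |p| < |c| < 1 and |c|^(n+1) < |x| <=
    |c|^n, both c and x / c^n have such values, and sharp is multiplicative. *)
Lemma sharp_absval x : 0 < v x < 1 -> exists y : Kb, v (sharp y) = v x.
Proof.
move=> /andP[x0 x1]; have [_ _ dense _] := hK.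
have [|c] := dense (1 - v p%:R); first by rewrite subr_gt0.
rewrite subKr => /andP[pc c1].
have c0 : 0 < v c := le_lt_trans vp0 pc.
have cn0 : c != 0 by apply: contraTneq c0 => ->; rewrite v0 ltxx.
have /ex_minnP[[|n] hn nmin] : exists n, v c ^+ n < v x.
- by apply: exists_expr_lt => //; rewrite absval_ge0.
- by move: hn; rewrite expr0 ltNge (ltW x1).
have xn : v x <= v c ^+ n by rewrite leNgt; apply/negP => /nmin; rewrite ltnn.
have [c' hc'] := sharp_absval_gt (ltW c1) pc.
have vd : v (x / c ^+ n) = v x / v c ^+ n by rewrite absvalM absvalV// absvalX.
have [||d hd] := @sharp_absval_gt (x / c ^+ n).
- by rewrite vd ler_pdivrMr ?exprn_gt0// mul1r.
- by rewrite vd; apply: lt_trans pc _; rewrite ltr_pdivlMr ?exprn_gt0// -exprS.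
exists (c' ^+ n * d).
by rewrite sharpM absvalM absval_sharpX hc' hd vd mulrC divfK// expf_neq0//
  gt_eqF.
Qed.

Lemma tilt_root (x : Kb) : exists y, y ^+ p = x.
Proof.
(* A p-th root in the tilt is the sequence shifted by one place. *)
have [|y [hy _]] := tilt_coord_bij Kb (s := fun n => tilt_coord n.+1 x).
  by move=> n; apply: tilt_coordX.
have coordX n z m : (0 < m)%N -> tilt_coord n (z ^+ m) =
    tilt_coord n (z : Kb) ^+ m.
  case: m => // m _.
  by elim: m => [|m ih]; rewrite ?expr1// exprS tilt_coordM ih -exprS.
exists y; have [|z [_ hz]] := tilt_coord_bij Kb (s := fun n => tilt_coord n x).
  by move=> n; apply: tilt_coordX.
rewrite -[RHS](hz x)//; apply/esym/hz => n.
by rewrite coordX ?prime_gt0// hy tilt_coordX.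
Qed.

Lemma tilt_rootX (x : Kb) n : exists y, y ^+ (p ^ n) = x.
Proof.
elim: n x => [|n ih] x; first by exists x; rewrite expn0 expr1.
have [y <-] := tilt_root x; have [z <-] := ih y; exists z.
by rewrite expnSr exprM.
Qed.

End Perfectoid.

(** * Absolute values on A *)

Section LocalField.
Variables (R : realType) (E : local_field R).
Let p := lf_p E.

Lemma lf_vE_p : lf_v E p%:R = p%:R^-1.
Proof. by have [<- _ _] := lf_padic E; rewrite -lf_v_ext scaler_nat. Qed.

Lemma lf_vE_p_lt1 : lf_v E p%:R < 1.
Proof.
have pp := lf_p_prime E.
by rewrite lf_vE_p invf_lt1 ?ltr1n ?ltr0n ?prime_gt1 ?prime_gt0.
Qed.

Lemma lf_q_gt1 : (1 < lf_q E)%N.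
Proof. exact: finNzRing_gt1. Qed.

Lemma lf_q_pX : exists n, lf_q E = (p ^ n)%N.
Proof.
suff pk : p \in [pchar lf_k E].
  by exists (logn p (lf_q E)); apply: card_pprimeChar.
rewrite inE lf_p_prime /= -(rmorph_nat (lf_res E)).
apply/eqP/(lf_resP E).2.
by rewrite rmorph_nat lf_vE_p_lt1.
Qed.

End LocalField.

Section Setting.
Variables (R : realType) (D : bkf_setting R).
Local Notation E := (bkE D).
Local Notation p := (lf_p E).
Local Notation q := (lf_q E).
Local Notation K := (bkK D).
Local Notation v := (pf_v K).
Local Notation Kb := (bkKb D).
Local Notation A := (bkA D).
Local Notation pi := (witt_str A (lf_pi E)).
Local Notation xi' := (bk_xi' D).

Let p_prime : prime p := lf_p_prime E.
Let perf : is_perfectoid v p := pf_perfectoid K.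
Let v0 : v 0 = 0 := perfectoid_absval0 perf.

Lemma theta_pi : \val (bk_theta D pi) = pf_in K (\val (lf_pi E)).
Proof. exact: bk_theta_str. Qed.

Lemma absval_theta_pi : 0 < v (\val (bk_theta D pi)) < 1.
Proof.
rewrite theta_pi pf_v_ext; have [pi0 [pi1 _]] := lf_pi_unif E.
by rewrite pi1 absval_gt0.
Qed.

(** Since |p| < 1, pi divides p in O_E. An approximation modulo p is thus one modulo pi, as the
    lifting argument for theta requires. *)
Lemma absval_p_le_pi z : v z <= v p%:R ->
  exists2 c, v c <= 1 & z = \val (bk_theta D pi) * c.
Proof.
move=> hz; exists (z / \val (bk_theta D pi)); last first.
  rewrite mulrC divfK//; apply: contraTneq (absval_theta_pi) => ->.
  by rewrite v0 ltxx.
have /andP[pi0 _] := absval_theta_pi.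
rewrite absvalM absvalV// ler_pdivrMr// mul1r; apply: le_trans hz _.
have [_ [_ /(_ p%:R)[|c hc]]] := lf_pi_unif E.
  by rewrite rmorph_nat lf_vE_p_lt1.
rewrite -(rmorph_nat (pf_in K)) theta_pi !pf_v_ext.
rewrite -(rmorph_nat (\val : valring (lf_v E) -> E)) hc rmorphM absvalM.
by rewrite ler_piMl ?absval_ge0//; case: c {hc}.
Qed.

Lemma theta_surj x : exists a, bk_theta D a = x.
Proof.
have /andP[pi0 pi1] := absval_theta_pi.
move: x; apply: witt_lift_surj => [c hc|x].
  apply: val_inj; rewrite rmorph0; apply: (absval_eq0 (a := v)).
  apply/eqP; rewrite eq_le absval_ge0 andbT leNgt; apply/negP => c0.
  have [|n] := @exists_expr_lt R (v (\val (bk_theta D pi))) _ _ c0.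
    by rewrite ltW.
  rewrite ltNge => /negP; apply; have [b ->] := hc n.
  rewrite rmorphM rmorphXn absvalM absvalX ler_piMr ?exprn_ge0 ?absval_ge0//.
  by case: b.
(* The Teichmueller lift of y maps to y^sharp, which agrees with x modulo p and hence modulo pi. *)
have [y hy] := sharp_approx p_prime perf Kb (valP x).
have y1 : tilt_v Kb y <= 1.
  rewrite tilt_le1; apply: absval_close_le (valP x) _.
  by apply: le_trans hy _; apply: ltW; case: perf.
have /absval_p_le_pi[c c1 hc] : v (\val x - sharp y) <= v p%:R.
  by rewrite absval_distC.
exists (bk_teich (ValRing y1 : valring (tilt_v Kb))), (ValRing c1).
apply: val_inj; rewrite rmorphD rmorphM /= bk_theta_teich /= -hc.
by rewrite addrC subrK.
Qed.

Lemma tilt_absval0 : tilt_v Kb 0 = 0.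
Proof.
apply: (@absval0 _ _ _ (\val (witt_red A (bk_xi D)) ^+ q)).
apply/eqP => h; have := bk_vb_norm D; rewrite h mulr1 => /eqP.
by rewrite -[1]/(1%:R) eqr_nat gtn_eqF// lf_q_gt1.
Qed.

Lemma absval_red_xi' : tilt_v Kb (\val (witt_red A xi')) = q%:R^-1.
Proof.
rewrite /bk_xi' bk_phi_red rmorphXn.
have q0 : (q%:R : R) != 0 by rewrite pnatr_eq0 -lt0n ltnW// lf_q_gt1.
by apply: (mulfI q0); rewrite bk_vb_norm divff.
Qed.

Lemma valring_root (x : valring (tilt_v Kb)) n :
  exists y : valring (tilt_v Kb), y ^+ (p ^ n) = x.
Proof.
have [y hy] := tilt_rootX p_prime (\val x) n.
have y1 : tilt_v Kb y <= 1.
  rewrite leNgt; apply/negP => y1.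
  have : 1 < tilt_v Kb (y ^+ (p ^ n)).
    by rewrite absvalX exprn_egt1// -lt0n expn_gt0 prime_gt0.
  by rewrite hy ltNge; have := valP x; rewrite inE => ->.
by exists (ValRing y1); apply: val_inj; rewrite rmorphXn.
Qed.

(** Since q is a power of p and O_K^flat is perfect, phi is surjective modulo pi; it fixes pi, so
    successive approximation applies. *)
Lemma phi_surj a : exists b, bk_phi D b = a.
Proof.
move: a; apply: witt_lift_surj.
  by rewrite bk_phi_str; apply: witt_separated.
move=> a; have [n qn] := lf_q_pX E.
have [y hy] := valring_root (witt_red A a) n.
have [b hb] := witt_red_surj A y.
have /witt_red_ker[c hc] : witt_red A (a - bk_phi D b) = 0.
  by rewrite rmorphB bk_phi_red hb qn hy subrr.
by exists b, c; rewrite bk_phi_str -hc addrC subrK.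
Qed.

(** As O_K^flat is reduced, an element killed by phi is divisible by pi. Since phi fixes pi and A
    has no pi-torsion, the quotient is killed too, and separatedness ends the descent. *)
Lemma phi_inj : injective (bk_phi D).
Proof.
have ker a : bk_phi D a = 0 -> exists2 b, a = pi * b & bk_phi D b = 0.
  move=> ha; have /witt_red_ker[b hb] : witt_red A a = 0.
    have := congr1 (witt_red A) ha; rewrite bk_phi_red rmorph0 => h.
    apply: val_inj; move/(congr1 val): h; rewrite rmorphXn rmorph0 => /eqP.
    by rewrite expf_eq0 => /andP[_ /eqP].
  exists b => //; apply: (witt_torsionfree (w := A)).
  by rewrite -bk_phi_str -rmorphM -hb.
move=> a b /eqP; rewrite -subr_eq0 -rmorphB => /eqP ab.
apply/eqP; rewrite -subr_eq0; apply/eqP/(witt_separated (w := A)) => n.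
elim: n (a - b) ab => [|n ih] c /ker; first by exists c; rewrite mul1r.
by move=> [d -> /ih[e ->]]; exists e; rewrite exprS mulrA.
Qed.

Lemma principal_xi' a : principal xi' (bk_phi D a) <-> bk_theta D a = 0.
Proof.
split=> [[b]|/bk_xiP[b ->]]; last by exists (bk_phi D b); rewrite rmorphM.
have [c <-] := phi_surj b; rewrite -rmorphM => /phi_inj ea.
by apply/bk_xiP; exists c.
Qed.

(** Bijectivity of phi identifies A / xi' with A / xi, which theta embeds into the domain O_K. *)
Lemma prime_xi' : prime_elt xi'.
Proof.
split.
- apply/eqP => h; have := absval_red_xi'; rewrite h !rmorph0 tilt_absval0.
  move=> /esym/eqP.
  by rewrite invr_eq0 pnatr_eq0 gtn_eqF// ltnW// lf_q_gt1.
- rewrite -(rmorph1 (bk_phi D)) => /principal_xi'; rewrite rmorph1 => /eqP.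
  by rewrite oner_eq0.
- move=> a b; have [a' <-] := phi_surj a; have [b' <-] := phi_surj b.
  rewrite -rmorphM => /principal_xi'; rewrite rmorphM => /(congr1 val).
  rewrite rmorphM rmorph0 => /eqP; rewrite mulf_eq0 => /orP[] /eqP h.
  + by left; apply/principal_xi'/val_inj; rewrite h rmorph0.
  + by right; apply/principal_xi'/val_inj; rewrite h rmorph0.
Qed.

Lemma xi'_pi : ~ principal xi' pi.
Proof.
rewrite -bk_phi_str => /principal_xi' h; have := absval_theta_pi.
by rewrite h rmorph0 v0 ltxx.
Qed.

Lemma pi_neq0 : pi != 0.
Proof.
by apply/eqP => h; apply: xi'_pi; rewrite h; exists 0; rewrite mul0r.
Qed.

Lemma BdR_separated :
  adic_separated (bk_toBdR D (loc_in _ (loc_in _ xi'))).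
Proof. by case: (bk_toBdRP D). Qed.

Let vdR := bk_vdR D.
Let gdR : {rmorphism A -> {fraction bkBdR D}} :=
  @tofrac (bkBdR D) \o A_to_BdR D.

Lemma prime_loc_xi' : prime_elt (loc_in [set pi] xi').
Proof. exact: prime_elt_loc prime_xi' xi'_pi pi_neq0. Qed.

Lemma absval_dR_int y : y != 0 -> exists k : int, vdR y = q%:R ^ k.
Proof.
apply: (normalized_absval_int (lf_q_gt1 E) (bk_vdRP D) BdR_separated).
exact: (completion_unit (lf_q_gt1 E) prime_loc_xi' (bk_toBdRP D) (bk_vdRP D)).
Qed.

Lemma absval_dR_dvd a n : vdR (gdR a) <= q%:R ^- n ->
  exists b, a = xi' ^+ n * b.
Proof.
move=> /(normalized_absval_dvd (lf_q_gt1 E) (bk_vdRP D))[c hc].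
have [b eb] := completion_dvd prime_loc_xi' (bk_toBdRP D) hc.
(* The quotient b lies in A[1/pi]. Clearing its denominator puts a power of pi in front of a, which
   is cancelled because pi is prime to xi'. *)
have [d [d' ed']] := loc_set1_num b pi_neq0.
apply: (prime_cancel prime_xi' (prime_notX (n := d) prime_xi' xi'_pi)).
apply: (@loc_in_inj _ [set pi]); rewrite !rmorphM rmorphXn /= eb.
by rewrite -mulrA ed'.
Qed.

Lemma absval_dR_xi' : vdR (gdR xi') = q%:R^-1.
Proof. exact: (bk_vdRP D).1. Qed.

Lemma absval_le_dR (F : fieldType) (w : absval R F) (g : {rmorphism A -> F})
    (hg : forall t, [set xi'] t -> g t != 0)
    (hdR : forall t, [set xi'] t -> gdR t != 0) z :
  (forall a, w (g a) <= 1) -> w (g xi') = q%:R^-1 ->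
  w (loc_map hg z) <= vdR (loc_map hdR z).
Proof.
move=> g1 gxi; have q0 : 0 < (q%:R : R) by rewrite ltr0n ltnW// lf_q_gt1.
have qV1 : (q%:R : R)^-1 < 1 by rewrite invf_lt1// ltr1n lf_q_gt1.
have w0 : w 0 = 0 by apply: (@absval0 _ _ _ (g xi')); rewrite gxi lt_eqF.
have d0 : vdR 0 = 0 by apply: normalized_absval0 (lf_q_gt1 E) (bk_vdRP D).
have le_pow a n : vdR (gdR a) <= q%:R ^- n -> w (g a) <= q%:R ^- n.
  move=> /absval_dR_dvd[b ->]; rewrite rmorphM rmorphXn absvalM absvalX gxi
    exprVn.
  by rewrite ler_piMr// invr_ge0 exprn_ge0// ltW.
(* If a vanishes in B'_dR, it is divisible by every power of xi' and w bounds it by every q^-n.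
   Otherwise |a| is a power of q: for a nonnegative exponent integrality of w suffices, and for a
   negative one [le_pow] applies with that very exponent. *)
have le_A a : w (g a) <= vdR (gdR a).
  have [a0|a0] := eqVneq (gdR a) 0.
    rewrite a0 d0 leNgt; apply/negP => wa.
    have [|n] := @exists_expr_lt R q%:R^-1 _ _ wa.
      by rewrite qV1 invr_ge0 ltW.
    by rewrite ltNge exprVn le_pow// a0 d0 invr_ge0 exprn_ge0// ltW.
  have [[n|n] hn] := absval_dR_int a0.
    rewrite hn; apply: le_trans (g1 a) _; rewrite -exprnP exprn_ege1// ler1n.
    exact: ltnW (lf_q_gt1 E).
  by rewrite hn NegzE -exprnN le_pow// hn NegzE -exprnN.
have [[a s] [/= hs ez]] := loc_elt_frac z.
rewrite /loc_map (loc_liftE hg (conj hs ez)) (loc_liftE hdR (conj hs ez)).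
have [n ->] := mulgen_set1 hs.
rewrite !absvalM !absvalV// !rmorphXn !absvalX gxi absval_dR_xi'.
by rewrite ler_wpM2r// invr_ge0 exprn_ge0// invr_ge0 ltW.
Qed.

Let vL := bk_vL D.
Let gL : {rmorphism A -> {fraction bkOL D}} := @tofrac (bkOL D) \o bk_toOL D.
Let piL := witt_str (bkOL D) (lf_pi E).

Lemma toOL_dvd a : tilt_v Kb (\val (witt_red A a)) < 1 ->
  exists b, bk_toOL D a = piL * b.
Proof.
move=> ha; apply/witt_red_ker; rewrite bk_toOL_red.
by apply/(bk_resP D).2.
Qed.

Lemma absval_L0 : vL 0 = 0.
Proof. exact: normalized_absval0 (lf_q_gt1 E) (bk_vLP D). Qed.

Lemma absval_L_lt1 a : tilt_v Kb (\val (witt_red A a)) < 1 ->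
  vL (gL a) <= q%:R^-1.
Proof.
move=> /toOL_dvd[b hb]; rewrite /gL /= hb rmorphM absvalM (bk_vLP D).1.
rewrite ler_piMr ?invr_ge0 ?ler0n//.
exact: (normalized_absval_le1 (bk_vLP D)).
Qed.

Lemma absval_L_xi' : vL (gL xi') = q%:R^-1.
Proof.
have q0 : 0 < (q%:R : R) by rewrite ltr0n ltnW// lf_q_gt1.
have qV1 : (q%:R : R)^-1 < 1 by rewrite invf_lt1// ltr1n lf_q_gt1.
have gL1 a : vL (gL a) <= 1 := normalized_absval_le1 (bk_vLP D) _.
apply/le_anti/andP; split; first by apply: absval_L_lt1; rewrite absval_red_xi'.
have [x hx] := sharp_absval p_prime perf Kb absval_theta_pi.
have /andP[pi0 pi1] := absval_theta_pi.
have x1 : tilt_v Kb x < 1 by rewrite tilt_lt1 hx.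
pose X : valring (tilt_v Kb) := ValRing (ltW x1).
have [Y hY] := valring_root X 1; rewrite expn1 in hY.
have y1 : tilt_v Kb (\val Y) < 1.
  rewrite ltNge; apply/negP => y1; have := x1; rewrite ltNge => /negP; apply.
  by rewrite -[x]/(\val X) -hY rmorphXn absvalX exprn_ege1.
have teichX m (z : valring (tilt_v Kb)) : (0 < m)%N ->
    bk_teich (z ^+ m) = bk_teich z ^+ m.
  case: m => // m _.
  by elim: m => [|m ih]; rewrite ?expr1// exprS bk_teichM ih -exprS.
have sx0 : v (sharp x) != 0 by rewrite hx gt_eqF.
have u1 : v (\val (bk_theta D pi) / sharp x) <= 1.
  by rewrite absvalM absvalV// -hx divff.
have [w hw] := theta_surj (ValRing u1).
(* Applying phi to this multiple of xi gives xi' phi(b) = pi - phi([x]) phi(w). If the last term is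
   smaller than pi in L, then |xi'| |phi(b)| = 1/q, and |phi(b)| <= 1 yields the lower bound on
   |xi'|. *)
have [b] : principal (bk_xi D) (pi - bk_teich X * w).
  apply/bk_xiP/val_inj; rewrite rmorphB rmorphM hw rmorphB rmorphM /=
    bk_theta_teich /=.
  rewrite mulrC divfK ?subrr ?rmorph0//.
  by apply: contra_neq sx0 => ->.
move=> /(congr1 (gL \o bk_phi D)) /=; rewrite !rmorphB !rmorphM bk_phi_str.
rewrite -!/(gL _) -/(bk_xi' D) => e.
(* The strict inequality comes from p >= 2: the lift of the root Y already has absolute value at
   most 1/q, so its p-th power has at most q^-p. *)
have teich_small : vL (gL (bk_phi D (bk_teich X))) < q%:R^-1.
  rewrite -hY teichX ?prime_gt0//.
  rewrite !rmorphXn absvalX.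
  have : vL (gL (bk_phi D (bk_teich Y))) <= q%:R^-1.
    apply: absval_L_lt1; rewrite bk_phi_red bk_teich_red rmorphXn absvalX.
    by rewrite exprn_ilt1 ?absval_ge0// -lt0n ltnW// lf_q_gt1.
  move=> h; apply: (@le_lt_trans _ _ (q%:R^-1 ^+ p)).
    by rewrite lerXn2r// nnegrE ?absval_ge0// invr_ge0 ltW.
  rewrite -[ltRHS]expr1 ltr_iXn2l ?invr_gt0// prime_gt1//.
have gLpi : vL (gL pi) = q%:R^-1 by rewrite /gL /= bk_toOL_str (bk_vLP D).1.
have : vL (gL (bk_phi D b)) * vL (gL xi') = q%:R^-1.
  rewrite -absvalM -e -gLpi; apply: absval_close.
  rewrite addrAC subrr sub0r absvalN.
  rewrite absvalM gLpi; apply: le_lt_trans teich_small.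
  by rewrite ler_piMr ?absval_ge0 ?gL1.
by move=> <-; rewrite ler_piMl ?absval_ge0 ?gL1.
Qed.

Lemma OL_separated : adic_separated piL.
Proof. exact: witt_separated. Qed.

(** O_L / pi is a field, so a has an inverse b modulo pi; then |a b| = 1 while both factors are at
    most 1. *)
Lemma absval_L_unit a : (forall b, a <> piL * b) -> vL (tofrac a) = 1.
Proof.
move=> ha; have ra : witt_red (bkOL D) a != 0.
  by apply/eqP => /witt_red_ker[b]; apply: ha.
have [b hb] := witt_red_surj (bkOL D) (witt_red _ a)^-1.
have /witt_red_ker[c hc] : witt_red (bkOL D) (a * b - 1) = 0.
  by rewrite rmorphB rmorphM hb divff// rmorph1 subrr.
have vab : vL (tofrac (a * b)) = 1.
  rewrite -(absval1 vL); apply: absval_close.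
  rewrite -(rmorph1 (@tofrac (bkOL D))) -rmorphB hc.
  rewrite rmorph1 absval1.
  exact: normalized_absval_lt1 (lf_q_gt1 E) (bk_vLP D) _.
have a1 := normalized_absval_le1 (bk_vLP D) a.
have b1 := normalized_absval_le1 (bk_vLP D) b.
apply/le_anti; rewrite a1 -vab rmorphM absvalM /=.
by rewrite ler_piMr ?absval_ge0.
Qed.

Lemma absval_L_int y : y != 0 -> exists k : int, vL y = q%:R ^ k.
Proof.
exact: (normalized_absval_int (lf_q_gt1 E) (bk_vLP D) OL_separated
  absval_L_unit).
Qed.

End Setting.

(** * Integrality and ordering of the types, and the two inequalities *)

Lemma ln_int (R : realType) (q : nat) (k : int) : (1 < q)%N ->
  ln (q%:R ^ k) / ln q%:R = k%:~R :> R.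
Proof.
move=> q1; have q0 : 0 < (q%:R : R) by rewrite ltr0n ltnW.
have lnq : ln (q%:R : R) != 0 by rewrite gt_eqF// ln_gt0// ltr1n.
case: k => n.
  by rewrite -exprnP lnXn// mulrnAl divff.
by rewrite NegzE -exprnN lnV ?posrE ?exprn_gt0// lnXn// mulNr mulrnAl divff//
  rmorphN.
Qed.

Section Types.
Variables (R : realType) (r q : nat) (F : fieldType) (v : absval R F).
Variables (x : 'I_r -> F) (d : 'rV[R]_r).
Hypotheses (q1 : (1 < q)%N) (x0 : forall k, x k != 0)
  (xdec : forall k l : 'I_r, (k <= l)%N -> v (x l) <= v (x k))
  (hd : forall k, d 0 k = ln (v (x k)) / ln q%:R).

Lemma Rge_position : Rge d.
Proof.
move=> k l kl; rewrite !hd ler_pM2r ?invr_gt0 ?ln_gt0 ?ltr1n//.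
by rewrite ler_ln ?posrE ?absval_gt0// xdec.
Qed.

Lemma Zge_position : (forall y, y != 0 -> exists k : int, v y = q%:R ^ k) ->
  Zge d.
Proof.
move=> vZ; split=> [|k]; first exact: Rge_position.
by have [n en] := vZ _ (x0 k); exists n; rewrite hd en ln_int.
Qed.

End Types.

Theorem proposition34 (R : realType) (D : bkf_setting R) (r : nat)
    (M : bkf_module D r) :
  type_le_in (@Zge R r) (tH_OL M) (tH_BdR M) /\
  type_le_in (@Rge R r) (tH_Ob M) (tH_BdR M).
Proof.
have [m m_basis] := bkf_free M.
have q1 := lf_q_gt1 (bkE D).
have q0 : (lf_q (bkE D))%:R^-1 != 0 :> R.
  by rewrite invr_eq0 pnatr_eq0 gtn_eqF// ltnW.
have [P [Q [PQ _ phiP]]] := linear_bij_matrix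
  (base_change_basis (to_inv_xi' D) (base_change_basis (bk_phi D) m_basis))
  (base_change_basis (to_inv_xi' D) m_basis) (bkf_phi_bij M).
(* The value 1/q of xi' makes it nonzero in each of the three fields, so that A[1/xi'] maps to all
   of them. *)
have nz (F : fieldType) (w : absval R F) (g : {rmorphism bkA D -> F}) :
    w 0 = 0 -> w (g (bk_xi' D)) = (lf_q (bkE D))%:R^-1 ->
    forall t, [set bk_xi' D] t -> g t != 0.
  by move=> w0 wg t ->; apply: contra_neq q0 => h; rewrite -wg h.
have dR0 := normalized_absval0 q1 (bk_vdRP D).
have hdR := nz _ (bk_vdR D) (@tofrac (bkBdR D) \o A_to_BdR D) dR0
  (absval_dR_xi' D).
have hL := nz _ (bk_vL D) (@tofrac (bkOL D) \o bk_toOL D) (absval_L0 D)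
  (absval_L_xi' D).
pose valO : {rmorphism valring (tilt_v (bkKb D)) -> bkKb D} := \val.
have hb := nz _ (tilt_v (bkKb D)) (valO \o witt_red (bkA D))
  (tilt_absval0 D) (absval_red_xi' D).
have tofrac_inj (O : idomainType) : injective (@tofrac O).
  by move=> a b /eqP; rewrite tofrac_eq => /eqP.
have [xd [nd xdecd hdd eP1 eP2]] := hodge_typeP m_basis PQ phiP hdR
  (tofrac_inj _) (normalized_absval_le1 (bk_vdRP D))
  (fun y => ((bk_vdRP D).2 y).1) dR0.
have [xl [nl xdecl hdl eL1 eL2]] := hodge_typeP m_basis PQ phiP hL
  (tofrac_inj _) (normalized_absval_le1 (bk_vLP D))
  (fun y => ((bk_vLP D).2 y).1) (absval_L0 D).
have [|||xb [nb xdecb hdb eB1 eB2]] := hodge_typeP m_basis PQ phiP hb _ _ _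
  (tilt_absval0 D).
- exact: val_inj.
- by move=> s; have := valP s.
- by move=> y y1; exists (ValRing y1).
have pd : has_position P (bk_vdR D) (loc_map hdR) xd by split.
have pl : has_position P (bk_vL D) (loc_map hL) xl by split.
have pb : has_position P (tilt_v (bkKb D)) (loc_map hb) xb by split.
split; split.
- exact: Zge_position q1 nl xdecl hdl (@absval_L_int _ D).
- exact: Zge_position q1 nd xdecd hdd (@absval_dR_int _ D).
- apply: (type_le_position PQ (absval_L0 D) dR0 _ q1 pl pd hdl hdd) => z.
  apply: absval_le_dR; last exact: absval_L_xi'.
  by move=> a; apply: (normalized_absval_le1 (bk_vLP D)).
- exact: Rge_position q1 nb xdecb hdb.
- exact: Rge_position q1 nd xdecd hdd.
- apply: (type_le_position PQ (tilt_absval0 D) dR0 _ q1 pb pd hdb hdd) => z.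
  apply: absval_le_dR; last exact: absval_red_xi'.
  by move=> a; apply: (valP (witt_red (bkA D) a)).
Qed.
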